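(* Let $\Omega\subset\mathbb R^d$ be open and bounded with $\mathscr L^d(\partial\Omega)=0$, let $\mathcal A$ be a constant rank homogeneous operator from $W$ to $X$, and let $A\in S_W\cap W_{\mathcal A}$. There exists an $L^1$-uniformly bounded sequence $\{w_j\}\subset C^\infty(\Omega;W)$ with $\mathcal Aw_j=0$ on $\Omega$ such that $w_j\,\mathscr L^d$ generates on $\Omega$ the Young measure $$\Big(\delta_A,\ \mathscr L^d\llcorner\Omega,\ \tfrac12(\delta_A+\delta_{-A})\Big).$$ In particular, $\{|w_j|\}$ is not equi-integrable on $\Omega$. (Moreover, if $A\notin\Lambda_{\mathcal A}$, then $A_1=A$ and $A_2=-A$ satisfy $A_1-A_2\notin\Lambda_{\mathcal A}$.)
   Context: $W,X$ are finite-dimensional real inner product spaces, $S_W$ and $B_W$ the unit sphere and open unit ball of $W$; $\mathscr L^d$ is Lebesgue measure. Operator: $\mathcal A=\sum_{|\alpha|=k}A_\alpha\partial^\alpha$, $A_\alpha\in\mathrm{Lin}(W,X)$, symbol $\mathbb A(\xi)=(2\pi\mathrm i)^k\sum_{|\alpha|=k}\xi^\alpha A_\alpha$ (the scalar factor is immaterial for kernels and ranks). Constant rank: $\operatorname{rank}\mathbb A(\xi)$ is a fixed positive integer for all $\xi\in\mathbb R^d\setminus\{0\}$. $\Lambda_{\mathcal A}=\bigcup_{\xi\ne0}\ker\mathbb A(\xi)$, $W_{\mathcal A}=\operatorname{span}\Lambda_{\mathcal A}$. $\mathbf E(\Omega;W)$ is the set of $f\in C(\Omega\times W)$ such that $(Sf)(x,\hat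 z)=(1-|\hat z|)f(x,\hat z/(1-|\hat z|))$ on $\Omega\times B_W$ extends continuously to $\overline{\Omega\times B_W}$; then $f^\infty(x,z)=\lim_{x'\to x,\,z'\to z,\,t\to\infty}f(x',tz')/t$ exists on $\overline\Omega\times W$. Saying that $w_j\mathscr L^d$ ($w_j\in L^1(\Omega;W)$) generates $(\delta_A,\mathscr L^d\llcorner\Omega,p)$ on $\Omega$, with $p\in\mathrm{Prob}(S_W)$, means that for all $f\in\mathbf E(\Omega;W)$ $$\int_\Omega f(x,w_j(x))\,dx\to\int_\Omega f(x,A)\,dx+\int_\Omega\int_{S_W}f^\infty(x,z)\,dp(z)\,dx.$$ Equi-integrable on $\Omega$: for every $\varepsilon>0$ there is $\delta>0$ such that $\sup_j\int_E|w_j|\le\varepsilon$ for every Borel $E\subset\Omega$ with $\mathscr L^d(E)\le\delta$. *)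

(* Defs.v *)
From HB Require Import structures.
From mathcomp Require Export all_boot all_order all_algebra.
From mathcomp Require Export all_classical all_reals all_analysis.

Set Implicit Arguments.
Unset Strict Implicit.
Unset Printing Implicit Defensive.

Import Order.TTheory GRing.Theory Num.Theory.
Export numFieldNormedType.Exports.

Local Open Scope classical_set_scope.
Local Open Scope ring_scope.

HB.mixin Record NormedModule_isInnerProduct (R : realType) V
    & NormedModule R V := {
  inner : V -> V -> R ;
  innerC : forall x y, inner x y = inner y x ;
  innerDl : forall x y z, inner (x + y) z = inner x z + inner y z ;
  innerZl : forall (a : R) x y, inner (a *: x) y = a * inner x y ;
  inner_norm : forall x, inner x x = `|x| ^+ 2
}.

#[short(type="finInnerType")]
HB.structure Definition FinInner (R : realType) :=
  {V of NormedModule R V & Vector R V & NormedModule_isInnerProduct R V}.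

Definition unit_sphere (R : realType) (W : finInnerType R) : set W :=
  [set z | `|z| = 1].

Definition unit_ball (R : realType) (W : finInnerType R) : set W :=
  [set z | `|z| < 1].

Definition borel (T : ptopologicalType) := g_sigma_algebraType (@open T).

HB.instance Definition _ (T : ptopologicalType) := Measurable.on (borel T).

Section lebesgue_tuple.
Variable R : realType.
Local Open Scope ereal_scope.
Local Notation TR := (measurableTypeR R).

Definition cons_pair n (p : TR * n.-tuple TR) : n.+1.-tuple TR :=
  [the n.+1.-tuple TR of p.1 :: p.2].

Lemma measurable_cons_pair n : measurable_fun setT (@cons_pair n).
Proof. exact: measurable_cons. Qed.

Definition cons_measure n
    (m : {sigma_finite_measure set (n.-tuple TR) -> \bar R}) :
    set (n.+1.-tuple TR) -> \bar R :=
  pushforward (@lebesgue_measure R \x m) (@cons_pair n).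

Section cons_measure.
Variables (n : nat) (m : {sigma_finite_measure set (n.-tuple TR) -> \bar R}).

Let cons_preimage (A : set (n.+1.-tuple TR)) :
  measurable A -> measurable (@cons_pair n @^-1` A).
Proof.
by move=> mA; rewrite -[X in measurable X]setTI; exact: measurable_cons_pair.
Qed.

Let cons_measure0 : cons_measure m set0 = 0.
Proof. by rewrite /cons_measure /pushforward preimage_set0 measure0. Qed.

Let cons_measure_ge0 A : 0 <= cons_measure m A.
Proof. by rewrite /cons_measure /pushforward; exact: measure_ge0. Qed.

Let cons_measure_sigma_additive : semi_sigma_additive (cons_measure m).
Proof.
move=> F mF tF mUF; rewrite /cons_measure /pushforward preimage_bigcup.
apply: measure_semi_sigma_additive.
- by move=> k; exact: cons_preimage.
- apply/trivIsetP => /= i j _ _ ij; rewrite -preimage_setI.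
  by move/trivIsetP : tF => /(_ _ _ _ _ ij) ->//; rewrite preimage_set0.
- by rewrite -preimage_bigcup; exact: cons_preimage.
Qed.

HB.instance Definition _ := isMeasure.Build _ _ _ (cons_measure m)
  cons_measure0 cons_measure_ge0 cons_measure_sigma_additive.

Lemma cons_measureE (A : set TR) (B : set (n.-tuple TR)) :
  measurable A -> measurable B ->
  cons_measure m [set t | A (thead t) /\ B [tuple of behead t]]
    = lebesgue_measure A * m B.
Proof.
move=> mA mB; rewrite -product_measure1E//; congr ((_ \x _) _).
apply/seteqP; split=> -[x t] /=; rewrite theadE.
  by move=> [Ax Bt]; split => //; move: Bt; congr B; exact: val_inj.
by move=> [/= Ax Bt]; split => //; move: Bt; congr B; exact: val_inj.
Qed.

Lemma measurable_consX (A : set TR) (B : set (n.-tuple TR)) :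
  measurable A -> measurable B ->
  measurable [set t : n.+1.-tuple TR | A (thead t) /\ B [tuple of behead t]].
Proof.
move=> mA mB.
have := @measurable_tnth _ TR n.+1 ord0 measurableT A mA.
have := @measurable_behead _ TR n measurableT B mB.
by rewrite !setTI => mb mt; apply: measurableI.
Qed.

Let cons_measure_sigma_finite : sigma_finite setT (cons_measure m).
Proof.
have /sigma_finiteP[F [FT Fnd Ffin]] := sigma_finiteT (@lebesgue_measure R).
have /sigma_finiteP[G [GT Gnd Gfin]] := sigma_finiteT m.
exists (fun k => [set t : n.+1.-tuple TR |
    F k (thead t) /\ G k [tuple of behead t]]).
  apply/esym; rewrite -subTset => t _.
  have [i _ Fi] : (\bigcup_i F i) (thead t) by rewrite -FT.
  have [j _ Gj] : (\bigcup_i G i) [tuple of behead t] by rewrite -GT.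
  exists (maxn i j) => //; split.
    by move: Fi; apply/subsetPset/Fnd; exact: leq_maxl.
  by move: Gj; apply/subsetPset/Gnd; exact: leq_maxr.
move=> k; have [mF Foo] := Ffin k; have [mG Goo] := Gfin k; split.
  exact: measurable_consX.
by rewrite cons_measureE// lte_mul_pinfty// ge0_fin_numE.
Qed.

HB.instance Definition _ := Measure_isSigmaFinite.Build _ _ _ (cons_measure m)
  cons_measure_sigma_finite.

End cons_measure.

Fixpoint lebesgue_tuple n : {sigma_finite_measure set (n.-tuple TR) -> \bar R} :=
  if n is n'.+1 then cons_measure (lebesgue_tuple n')
  else dirac ([tuple] : 0.-tuple TR).

Lemma measurable_tuple_box n (F : 'I_n -> set TR) :
  (forall i, measurable (F i)) ->
  measurable [set t : n.-tuple TR | forall i, F i (tnth t i)].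
Proof.
move=> mF; rewrite (_ : [set _ | _] =
    \bigcap_(i in [set: 'I_n]) ((@tnth n TR)^~ i @^-1` F i)); last first.
  apply/seteqP; split=> t Ft i; first by move=> _; exact: Ft.
  exact: (Ft i Logic.I).
apply: fin_bigcap_measurable; first exact: finite_finset.
by move=> i _; rewrite -[X in measurable X]setTI; exact: measurable_tnth.
Qed.

Lemma lebesgue_tuple_box n (F : 'I_n -> set TR) :
  (forall i, measurable (F i)) ->
  lebesgue_tuple n [set t | forall i, F i (tnth t i)] =
    \prod_(i < n) lebesgue_measure (F i).
Proof.
elim: n F => [|n IH] F mF.
  by rewrite big_ord0 /= diracE mem_set// => -[].
rewrite big_ord_recl -IH; last by move=> i; exact: mF.
rewrite /= -cons_measureE//; last first.
  by apply: (@measurable_tuple_box _ (fun j => F (lift ord0 j))) => i; exact: mF.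
have bS (t : n.+1.-tuple TR) i : tnth [tuple of behead t] i = tnth t (lift ord0 i).
  by rewrite tnth_behead; congr tnth; apply/val_inj; rewrite /= inordK// ltnS.
congr (cons_measure _ _); apply/seteqP; split => t /=.
  by move=> Ft; split=> [|i]; [exact: Ft|rewrite bS; exact: Ft].
move=> [F0 FS] i; case: (unliftP ord0 i) => [j|] ->; last exact: F0.
by have := FS j; rewrite bS.
Qed.

End lebesgue_tuple.

Section lebesgue_rV.
Variables (R : realType) (d : nat).
Local Open Scope ereal_scope.
Local Notation TR := (measurableTypeR R).

Definition row_of_tuple (t : d.-tuple TR) : borel 'rV[R]_d :=
  \row_(i < d) tnth t i.

Lemma measurable_row_of_tuple : measurable_fun setT row_of_tuple.
Proof.
apply: (@measurability _ _ _ (borel 'rV[R]_d) setT _ (@open 'rV[R]_d)) => //.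
move=> _ [U oU <-]; rewrite setTI.
pose box (f : {ffun 'I_d -> rat * rat}) (i : 'I_d) : set TR :=
  [set` `]ratr (f i).1, ratr (f i).2[%R].
pose F f : set (d.-tuple TR) :=
  if `[< forall x : 'rV[R]_d, (forall i, box f i (x ord0 i)) -> U x >]
  then [set t | forall i, box f i (tnth t i)] else set0.
rewrite (_ : _ @^-1` _ = \bigcup_f F f); last first.
  apply/seteqP; split=> t /=; last first.
    move=> [f _]; rewrite /F; case: asboolP => // fU ft.
    by apply: fU => i; rewrite mxE.
  move=> Ut.
  have /nbhs_ballP[e /= e0 eU] : nbhs (row_of_tuple t) U by exact: open_nbhs_nbhs.
  have /choice[f fP] (i : 'I_d) : exists pq : rat * rat,
      [/\ tnth t i - e < ratr pq.1, ratr pq.1 < tnth t i,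
          tnth t i < ratr pq.2 & ratr pq.2 < tnth t i + e]%R.
    have /rat_in_itvoo[p] : (tnth t i - e < tnth t i)%R by rewrite gtrBl.
    have /rat_in_itvoo[q] : (tnth t i < tnth t i + e)%R by rewrite ltrDl.
    rewrite !in_itv /= => /andP[q1 q2] /andP[p1 p2].
    by exists (p, q); split.
  exists [ffun i => f i] => //; rewrite /F; case: asboolP => [_ i|]; last first.
    case=> x xf; apply: eU; split=> // i j; rewrite ord1 mxE /ball /=.
    have := xf j; rewrite /box /= in_itv /= ffunE => /andP[fx xf'].
    have [h1 _ _ h4] := fP j.
    by rewrite ltr_distlC (lt_trans h1 fx) (lt_trans xf' h4).
  by rewrite /box /= in_itv /= ffunE; have [_ -> ->] := fP i.
apply: countable_bigcupT_measurable => // f; rewrite /F.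
case: ifP => // _; apply: measurable_tuple_box => i; exact: measurable_itv.
Qed.

Definition lebesgue_rV : set (borel 'rV[R]_d) -> \bar R :=
  pushforward (lebesgue_tuple R d) row_of_tuple.

Let preimage_row (A : set (borel 'rV[R]_d)) :
  measurable A -> measurable (row_of_tuple @^-1` A).
Proof.
by move=> mA; rewrite -[X in measurable X]setTI; exact: measurable_row_of_tuple.
Qed.

Let lebesgue_rV0 : lebesgue_rV set0 = 0.
Proof. by rewrite /lebesgue_rV /pushforward preimage_set0 measure0. Qed.

Let lebesgue_rV_ge0 A : 0 <= lebesgue_rV A.
Proof. by rewrite /lebesgue_rV /pushforward; exact: measure_ge0. Qed.

Let lebesgue_rV_sigma_additive : semi_sigma_additive lebesgue_rV.
Proof.
move=> F mF tF mUF; rewrite /lebesgue_rV /pushforward preimage_bigcup.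
apply: measure_semi_sigma_additive.
- by move=> k; exact: preimage_row.
- apply/trivIsetP => /= i j _ _ ij; rewrite -preimage_setI.
  by move/trivIsetP : tF => /(_ _ _ _ _ ij) ->//; rewrite preimage_set0.
- by rewrite -preimage_bigcup; exact: preimage_row.
Qed.

HB.instance Definition _ := isMeasure.Build _ _ _ lebesgue_rV
  lebesgue_rV0 lebesgue_rV_ge0 lebesgue_rV_sigma_additive.

Lemma lebesgue_rV_box (F : 'I_d -> set R) :
  (forall i, measurable (F i : set TR)) ->
  lebesgue_rV [set x | forall i, F i (x ord0 i)] =
    \prod_(i < d) lebesgue_measure (F i).
Proof.
move=> mF; rewrite -lebesgue_tuple_box// /lebesgue_rV /pushforward.
congr (lebesgue_tuple R d _).
by apply/seteqP; split=> t /= Ft i; have := Ft i; rewrite mxE.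
Qed.

End lebesgue_rV.

Section operators.
Variables (R : realType) (d k : nat) (W X : finInnerType R).
Implicit Types (w : 'rV[R]_d -> W) (Omega : set 'rV[R]_d).

Definition partial (i : 'I_d) w : 'rV[R]_d -> W := fun x => 'D_('e_i) w x.

Definition partials (s : seq 'I_d) w : 'rV[R]_d -> W := foldr partial w s.

(* For open Omega: every iterated partial derivative exists and is continuous
   on Omega. The values of w outside Omega play no role. *)
Definition smooth_on Omega w :=
  forall (s : seq 'I_d) (x : 'rV[R]_d), Omega x ->
    {for x, continuous (partials s w)} /\
    forall i, derivable (partials s w) x 'e_i.

(* The multi-indices alpha in N^d with |alpha| = k; each entry is at most k. *)
Definition multi_index :=
  {alpha : {ffun 'I_d -> 'I_k.+1} | (\sum_i alpha i == k)%N}.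

HB.instance Definition _ := Finite.on multi_index.

Definition mpartial (alpha : multi_index) w : 'rV[R]_d -> W :=
  foldr (fun i => iter (val alpha i) (partial i)) w (enum 'I_d).

Definition diffop (Aop : multi_index -> 'Hom(W, X)) w (x : 'rV[R]_d) : X :=
  \sum_(alpha : multi_index) Aop alpha (mpartial alpha w x).

(* The principal symbol without its nonzero scalar factor (2 pi i)^k, which
   affects neither kernels nor ranks. *)
Definition symbol (Aop : multi_index -> 'Hom(W, X)) (xi : 'rV[R]_d) :
    'Hom(W, X) :=
  \sum_(alpha : multi_index)
    (\prod_i xi ord0 i ^+ val alpha i) *: Aop alpha.

Definition constant_rank (Aop : multi_index -> 'Hom(W, X)) :=
  exists2 r, (0 < r)%N & forall xi, xi != 0 -> \dim (limg (symbol Aop xi)) = r.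

Definition wave_cone (Aop : multi_index -> 'Hom(W, X)) : set W :=
  [set z | exists2 xi, xi != 0 & z \in lker (symbol Aop xi)].

Definition linear_span (L : set W) : set W :=
  [set z | exists n (c : 'I_n -> R) (v : 'I_n -> W),
    (forall i, L (v i)) /\ z = \sum_i c i *: v i].

End operators.

Arguments multi_index : clear implicits.

Section young_measures.
Variables (R : realType) (d : nat) (W : finInnerType R).
Implicit Types (Omega : set 'rV[R]_d) (f : 'rV[R]_d * W -> R).
Implicit Types (w : 'rV[R]_d -> W).

Definition sphere_transform f : 'rV[R]_d * W -> R :=
  fun p => (1 - `|p.2|) * f (p.1, (1 - `|p.2|)^-1 *: p.2).

(* E(Omega; W): continuous integrands with a regular recession function. *)
Definition integrands Omega : set ('rV[R]_d * W -> R) :=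
  [set f | {within Omega `*` setT, continuous f} /\
    exists2 g : 'rV[R]_d * W -> R,
      {within closure (Omega `*` @unit_ball R W), continuous g} &
      {in Omega `*` @unit_ball R W, g =1 sphere_transform f}].

(* The limit of f (x', t z') / t as x' -> x in Omega, z' -> z and t -> +oo. *)
Definition recession Omega f (x : 'rV[R]_d) (z : W) : R :=
  lim ((fun q : ('rV[R]_d * W) * R => f (q.1.1, q.2 *: q.1.2) / q.2) @
    filter_prod (filter_prod (within Omega (nbhs x)) (nbhs z))
                (pinfty_nbhs R)).

Definition L1_on Omega w :=
  measurable_fun (Omega : set (borel 'rV[R]_d))
    (w : borel 'rV[R]_d -> borel W) /\
  (\int[@lebesgue_rV R d]_(x in Omega) `|w x|%:E < +oo)%E.

Definition L1_bounded Omega (w : nat -> 'rV[R]_d -> W) :=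
  exists M : R, forall j,
    (\int[@lebesgue_rV R d]_(x in Omega) `|w j x|%:E <= M%:E)%E.

Definition equi_integrable Omega (w : nat -> 'rV[R]_d -> W) :=
  forall eps : R, 0 < eps -> exists2 delta : R, 0 < delta &
    forall E : set (borel 'rV[R]_d), measurable E -> E `<=` Omega ->
      (lebesgue_rV E <= delta%:E)%E ->
      (ereal_sup [set \int[@lebesgue_rV R d]_(x in E) `|w j x|%:E | j in setT]
        <= eps%:E)%E.

(* The maps w j, seen as densities with respect to Lebesgue measure, generate
   on Omega the Young measure (delta_A, Lebesgue measure on Omega, p), where p
   is a probability measure carried by the unit sphere. *)
Definition generates Omega (w : nat -> 'rV[R]_d -> W) (A : W)
    (p : probability (borel W) R) :=
  [/\ forall j, L1_on Omega (w j),
      p (@unit_sphere R W) = 1%E &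
      forall f, integrands Omega f ->
        (\int[@lebesgue_rV R d]_(x in Omega) (f (x, w j x))%:E
           @[j --> \oo] -->
         \int[@lebesgue_rV R d]_(x in Omega) (f (x, A))%:E +
         \int[@lebesgue_rV R d]_(x in Omega)
           \int[p]_(z in @unit_sphere R W) (recession Omega f x z)%:E)%E].

End young_measures.

Section two_point.
Variables (R : realType) (W : finInnerType R) (A : W).
Local Open Scope ereal_scope.

Definition two_point : set (borel W) -> \bar R :=
  mscale (2^-1 : R)%R%:nng%R
    (measure_add (dirac (A : borel W)) (dirac (- A : borel W)%R)).

HB.instance Definition _ := Measure.on two_point.

Let two_point_setT : two_point setT = 1.
Proof.
rewrite /two_point /mscale /= /msum !big_ord_recl big_ord0 adde0 /= !diracT.
by rewrite -EFinD -EFinM /= mulVf.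
Qed.

HB.instance Definition _ := Measure_isProbability.Build _ _ _ two_point
  two_point_setT.

End two_point.

(* Main.v *)
(* All fields are trigonometric polynomials. A slow scalar times a fast A-free
   field has its frequencies close in direction to those of the fast field;
   constant rank makes the kernel of the symbol lower semicontinuous, so the
   product is corrected to an A-free field at a small uniform cost. Products of
   independent oscillations behave like products of independent random variables,
   which turns the construction into a martingale: for v in the wave cone there
   are A-free fields (H^2 - 1) v with H^2 of mean 1 and concentrated on a set of
   small measure. Starting from A-free fields nearly equal to y A with y of mean 0
   and |y| of mean 1, concentrated, a staircase laminate with many small steps
   produces such fields for A + v. By induction one reaches every A in the span of
   the cone: Z is nearly q A, with q small off a set of small measure, of mean 0
   and with |q| of mean 1. Then w_j(x) = A + Z_j(n_j x) with n_j large, and the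
   Riemann-Lebesgue lemma, uniform over Lipschitz test functions of given
   constants, distributes the concentrations uniformly over Omega, half in the
   direction A and half in the direction -A. *)

Require Import Defs.
From mathcomp Require Import ring lra measurable_realfun.

Set Implicit Arguments.
Unset Strict Implicit.
Unset Printing Implicit Defensive.

Import Order.TTheory GRing.Theory Num.Theory.

Local Open Scope classical_set_scope.
Local Open Scope ring_scope.

(** * Trigonometric polynomials *)

(** Smallness is always meant in mean, yet |y| and minima are not trigonometric polynomials and have
    no formal mean. They are therefore replaced or dominated pointwise by trigonometric polynomials
    ([kap], [rho], [tau]), whose mean is the constant coefficient. This is why concentration goes
    through a square: with H^2 of mean 1 and H of tiny mean, arithmetic and geometric means give 2
    min (a, b H^2) <= (a + b) H, a polynomial bound for a truncated quantity. Frequencies are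
    arbitrary real vectors, since those of the wave cone need not have a common period; no torus is
    available, and the mean stays formal until a dilation turns it into a weak limit on [Omega]. The
    fields have no zero frequency, hence mean zero, and so the concentrated mass splits evenly
    between A and -A. For A outside the wave cone no single wave points along A. The staircase
    leaves an uncompensated multiple of the added cone vector, of mean size bounded independently of
    the number of rounds; dividing by that number removes it. *)

Section trigonometric_polynomials.
Variables (R : realType) (d : nat).
Implicit Types (u v : 'rV[R]_d -> R) (z x y : 'rV[R]_d).

Definition dot z x : R := \sum_i z ord0 i * x ord0 i.

Lemma dotDl z y x : dot (z + y) x = dot z x + dot y x.
Proof. by rewrite -big_split; apply: eq_bigr => i _; rewrite mxE mulrDl. Qed.

Lemma dotZl (a : R) z x : dot (a *: z) x = a * dot z x.
Proof. by rewrite /dot mulr_sumr; apply: eq_bigr => i _; rewrite mxE mulrA. Qed.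

Lemma dotC z x : dot z x = dot x z.
Proof. by apply: eq_bigr => i _; rewrite mulrC. Qed.

Lemma dotDr z x y : dot z (x + y) = dot z x + dot z y.
Proof. by rewrite dotC dotDl !(dotC z). Qed.

Lemma dotZr (a : R) z x : dot z (a *: x) = a * dot z x.
Proof. by rewrite dotC dotZl dotC. Qed.

Lemma dot0l x : dot 0 x = 0.
Proof. by rewrite -(scale0r 0) dotZl mul0r. Qed.

Lemma dotNl z x : dot (- z) x = - dot z x.
Proof. by rewrite -scaleN1r dotZl mulN1r. Qed.

Lemma cosM (a b : R) : cos a * cos b = (cos (a + b) + cos (a - b)) / 2.
Proof. by rewrite cosB cosD; field. Qed.

Lemma dot_continuous z : continuous (dot z).
Proof.
apply: continuous_big => [|i _ x]; first exact: add_continuous.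
apply: (@cvgMl_tmp _ _ (nbhs x) _ (fun x => x ord0 i)).
exact: coord_continuous.
Qed.

Definition trig (l : seq (R * 'rV[R]_d)) x : R :=
  \sum_(p <- l) p.1 * cos (dot p.2 x).

Definition trig_mean (l : seq (R * 'rV[R]_d)) : R :=
  \sum_(p <- l | p.2 == 0) p.1.

(** The mean [m] is attached to some cosine expansion of [u] and is not an integral average; every
    operation carries it along, and it meets integration only in [trig_weak_limit]. Cosines suffice,
    because their products are again sums of cosines. *)
Definition is_trig u (m : R) := exists2 l, u =1 trig l & trig_mean l = m.

Lemma is_trig_ext u v m : u =1 v -> is_trig u m -> is_trig v m.
Proof. by move=> uv [l ul <-]; exists l => // x; rewrite -uv ul. Qed.

Lemma is_trig_eqm u m n : m = n -> is_trig u m -> is_trig u n.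
Proof. by move=> ->. Qed.

Lemma is_trigD u v m n :
  is_trig u m -> is_trig v n -> is_trig (u \+ v) (m + n).
Proof.
move=> [l ul <-] [k vk <-]; exists (l ++ k).
  by move=> x; rewrite /= ul vk /trig big_cat.
by rewrite /trig_mean big_cat.
Qed.

Lemma is_trigZ u m (a : R) : is_trig u m -> is_trig (fun x => a * u x) (a * m).
Proof.
move=> [l ul <-]; exists [seq (a * p.1, p.2) | p <- l].
  move=> x; rewrite ul /trig big_map mulr_sumr.
  by apply: eq_bigr => p _; rewrite mulrA.
by rewrite /trig_mean big_map mulr_sumr.
Qed.

Lemma is_trig_cos (a : R) z :
  is_trig (fun x => a * cos (dot z x)) (if z == 0 then a else 0).
Proof.
exists [:: (a, z)]; first by move=> x; rewrite /trig big_seq1.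
by rewrite /trig_mean big_cons big_nil addr0.
Qed.

Lemma is_trig_cst (a : R) : is_trig (fun=> a) a.
Proof.
apply: is_trig_ext (is_trig_eqm _ (is_trig_cos a 0)); last by rewrite eqxx.
by move=> x; rewrite dot0l cos0 mulr1.
Qed.

Lemma is_trigB u v m n :
  is_trig u m -> is_trig v n -> is_trig (fun x => u x - v x) (m - n).
Proof.
move=> tu /(is_trigZ (- 1)) tv; rewrite -(mulN1r n).
by apply: is_trig_ext (is_trigD tu tv) => x /=; rewrite mulN1r.
Qed.

(** A polynomial has finitely many waves, so properties that hold eventually in a dilation parameter
    pass from single waves to sums. *)
Lemma is_trig_ind (Q : ('rV[R]_d -> R) -> R -> Prop)
    u m :
  is_trig u m ->
  (forall v w n, v =1 w -> Q v n -> Q w n) -> Q (fun=> 0) 0 ->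
  (forall a z, Q (fun x => a * cos (dot z x)) (if z == 0 then a else 0)) ->
  (forall v w n k, Q v n -> Q w k -> Q (v \+ w) (n + k)) ->
  Q u m.
Proof.
move=> [l ul <-] Qe Q0 Qc QD; apply: (Qe _ _ _ (fsym ul)); move=> {u m ul}.
elim: l => [|[a z] l IH].
  rewrite /trig_mean big_nil; apply: Qe Q0 => x; by rewrite /trig big_nil.
rewrite /trig_mean big_cons; have := QD _ _ _ _ (Qc a z) IH.
rewrite /trig_mean /=; case: ifP => _; rewrite ?add0r; apply: Qe => x;
  by rewrite /trig big_cons.
Qed.

Lemma is_trig_bounded u m : is_trig u m ->
  exists2 C : R, 0 < C & forall x, `|u x| <= C.
Proof.
move=> [l ul _]; exists (1 + \sum_(p <- l) `|p.1|).
  by rewrite ltr_pwDl// sumr_ge0.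
move=> x; rewrite ul /trig (le_trans (ler_norm_sum _ _ _))//.
rewrite -[leLHS]add0r lerD// ler_sum// => p _.
by rewrite normrM ler_piMr// ler_norml cos_geN1 cos_le1.
Qed.

Lemma is_trig_continuous u m : is_trig u m -> continuous u.
Proof.
move=> [l ul _]; rewrite (funext ul).
apply: continuous_big => [|p _ x]; first exact: add_continuous.
apply: (@cvgMl_tmp _ _ (nbhs x) _ (fun x => cos (dot p.2 x))).
by apply: continuous_comp; [exact: dot_continuous|exact: continuous_cos].
Qed.

Lemma dilated_frequency_neq0 z y : y != 0 ->
  \forall N \near +oo, z + N *: y != 0.
Proof.
move=> /rV0Pn[i yi]; exists (`|z ord0 i| / `|y ord0 i|).
split; first exact: num_real.
move=> N /=; rewrite ltr_pdivrMr ?normr_gt0// => zN.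
apply/rV0Pn; exists i; rewrite !mxE addrC; apply/eqP => /eqP.
rewrite addr_eq0 => /eqP /(congr1 (fun t : R => `|t|)).
rewrite normrN normrM => E; move: zN; rewrite -E ltNge ler_wpM2r//.
exact: ler_norm.
Qed.

(* The frequencies z + N y with y != 0 do not vanish for large N: this is the
   asymptotic independence of slow and fast oscillations. *)
Lemma is_trigM_dilate u v m n : is_trig u m -> is_trig v n ->
  \forall N \near +oo, is_trig (fun x => u x * v (N *: x)) (m * n).
Proof.
move=> tu tv.
apply: (is_trig_ind (Q := fun u m => \forall N \near +oo,
    is_trig (fun x => u x * v (N *: x)) (m * n)) tu) => {u m tu}.
- move=> u w m uw; apply: filterS => N; apply: is_trig_ext => x.
  by rewrite uw.
- near=> N; rewrite mul0r; apply: is_trig_ext (is_trig_cst 0) => x.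
  by rewrite mul0r.
- move=> a z.
  apply: (is_trig_ind (Q := fun v n => \forall N \near +oo,
    is_trig (fun x => a * cos (dot z x) * v (N *: x))
      ((if z == 0 then a else 0) * n)) tv) => {v n tv}.
  + move=> u w m uw; apply: filterS => N; apply: is_trig_ext => x.
    by rewrite uw.
  + near=> N; rewrite mulr0; apply: is_trig_ext (is_trig_cst 0) => x.
    by rewrite mulr0.
  + move=> b y; have [->|y0] := eqVneq y 0.
      near=> N; have := is_trigZ b (is_trig_cos a z); rewrite mulrC.
      by apply: is_trig_ext => x; rewrite dot0l cos0 mulr1 mulrC.
    have Ny0 : - y != 0 by rewrite oppr_eq0.
    have n1 := dilated_frequency_neq0 z y0.
    have n2 := dilated_frequency_neq0 z Ny0.
    near=> N; rewrite mulr0.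
    have /negbTE zy : z + N *: y != 0 by near: N; exact: n1.
    have /negbTE zNy : z + N *: - y != 0 by near: N; exact: n2.
    have := is_trigD (is_trig_cos (a * b / 2) (z + N *: y))
                     (is_trig_cos (a * b / 2) (z + N *: - y)).
    rewrite zy zNy addr0; apply: is_trig_ext => x /=.
    by rewrite !dotDl !dotZl dotNl dotZr mulrN mulrACA cosM; field.
  + move=> v w k l; apply: filterS2 => N tv tw; rewrite mulrDr.
    by apply: is_trig_ext (is_trigD tv tw) => x /=; rewrite mulrDr.
- move=> w1 w2 k l; apply: filterS2 => N t1 t2; rewrite mulrDl.
  by apply: is_trig_ext (is_trigD t1 t2) => x /=; rewrite mulrDl.
Unshelve. all: by end_near. Qed.

Lemma is_trig_dilate u m : is_trig u m ->
  \forall N \near +oo, is_trig (fun x => u (N *: x)) m.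
Proof.
move=> /(is_trigM_dilate (is_trig_cst 1)); rewrite mul1r.
by apply: filterS => N; apply: is_trig_ext => x; rewrite mul1r.
Qed.

End trigonometric_polynomials.

(** * Kernels of the symbol *)

Lemma ler_entry_norm (R : realType) m n (M : 'M[R]_(m, n)) i j :
  `|M i j| <= `|M|.
Proof.
rewrite /Num.norm /= mx_normrE.
exact: (le_bigmax_cond _ (fun ij : 'I_m * 'I_n => `|M ij.1 ij.2|) (j := (i, j))).
Qed.

(** * Equivalence of norms and compactness in finite dimension *)

Section finite_dimension.
Variables (R : realType) (W : finInnerType R).

Let n := \dim {: W}.
Let comb (r : 'rV[R]_n) : W := \sum_(i < n) r ord0 i *: (vbasis {: W})`_i.

Let combE (w : W) :
  comb (\row_i coord (vbasis {: W}) i w) = w.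
Proof.
rewrite [RHS](coord_vbasis (memvf w)) /comb.
by apply: eq_bigr => i _; rewrite mxE.
Qed.

Let combZ a r : comb (a *: r) = a *: comb r.
Proof.
by rewrite /comb scaler_sumr; apply: eq_bigr => i _; rewrite mxE scalerA.
Qed.

Let comb_inj r : comb r = 0 -> r = 0.
Proof.
move=> r0.
have /freeP/(_ (fun i => r ord0 i) r0) ri := basis_free (vbasisP {: W}).
by apply/rowP => i; rewrite ri mxE.
Qed.

Let comb_continuous : continuous comb.
Proof.
apply: continuous_big => [|i _ r]; first exact: add_continuous.
apply: (@cvgZr_tmp _ _ _ (nbhs r) _ (fun x : 'rV[R]_n => x ord0 i)).
exact: coord_continuous.
Qed.

(** The unit sphere of coordinate rows has a compact image in [W] that avoids 0, hence avoids a ball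
    of radius [e]; rescaling gives the constant [1 / e]. *)
Lemma coord_bounded : exists2 C : R, 0 < C &
  forall (w : W) i, `|coord (vbasis {: W}) i w| <= C * `|w|.
Proof.
pose S : set 'rV[R]_n := [set r | `|r| = 1].
have cS : compact S.
  apply: bounded_closed_compact.
    by exists 1; split => // x x1 r /= ->; exact: ltW.
  apply: (@closed_comp _ _ (fun r : 'rV[R]_n => `|r|) [set 1]) => //.
  by move=> r _; exact: norm_continuous.
have /compact_closed : compact (comb @` S).
  by apply: continuous_compact => //; exact: continuous_subspaceT comb_continuous.
move=> /(_ (@norm_hausdorff _ _)) /closed_openC oS.
have /nbhs_ballP[e /= e0 eS] : nbhs 0 (~` (comb @` S)).
  apply: open_nbhs_nbhs; split => // -[r r1 /comb_inj r0].
  by move: r1; rewrite /S /= r0 normr0 => /eqP; rewrite eq_sym oner_eq0.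
exists e^-1; first by rewrite invr_gt0.
move=> w i; set r := \row_i coord (vbasis {: W}) i w.
have -> : coord (vbasis {: W}) i w = r ord0 i by rewrite mxE.
apply: le_trans (ler_entry_norm _ _ _) _.
have [->|r0] := eqVneq r 0; first by rewrite normr0 mulr_ge0// invr_ge0 ltW.
have nr : 0 < `|r| by rewrite normr_gt0.
rewrite mulrC ler_pdivlMr// leNgt; apply/negP => we.
apply: (eS (comb (`|r|^-1 *: r))).
  rewrite -ball_normE /= sub0r normrN combZ combE normrZ normfV normr_id.
  by rewrite mulrC ltr_pdivrMr// mulrC.
exists (`|r|^-1 *: r) => //.
by rewrite /S /= normrZ normfV normr_id mulVf// gt_eqF.
Qed.

Lemma lfun_bounded (X : finInnerType R) (L : 'Hom(W, X)) :
  exists2 C : R, 0 < C & forall w, `|L w| <= C * `|w|.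
Proof.
have [C C0 wC] := coord_bounded.
exists (1 + \sum_(i < n) C * `|L (vbasis {: W})`_i|).
  by rewrite ltr_pwDl// sumr_ge0// => i _; rewrite mulr_ge0// ltW.
move=> w; rewrite {1}(coord_vbasis (memvf w)) linear_sum.
apply: le_trans (ler_norm_sum _ _ _) _.
rewrite mulrDl -[leLHS]add0r lerD ?mul1r// mulr_suml ler_sum// => i _.
by rewrite linearZ normrZ mulrAC ler_wpM2r.
Qed.

Lemma closed_unit_ball_compact : compact [set w : W | `|w| <= 1].
Proof.
have [C C0 wC] := coord_bounded.
have cK : compact (comb @` [set r : 'rV[R]_n | forall i : 'I_n, `[- C, C]%classic (r ord0 i)]).
  apply: continuous_compact; first exact: continuous_subspaceT comb_continuous.
  by apply: (rV_compact (A := fun=> `[- C, C]%classic)) => i; exact: segment_compact.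
apply: (subclosed_compact _ cK).
- apply: (@closed_comp _ _ (fun r : W => `|r|) [set x | x <= 1]) => //.
  by move=> r _; exact: norm_continuous.
- move=> w /= w1; exists (\row_i coord (vbasis {: W}) i w); last exact: combE.
  move=> i /=; rewrite mxE in_itv /= -ler_norml.
  by apply: le_trans (wC _ _) _; rewrite ler_piMr// ltW.
Qed.

End finite_dimension.

(** * Stability of kernels under perturbations of equal rank *)

Section kernel_perturbation.
Variables (R : realType) (W X : finInnerType R).

(* A left inverse of L0 on a complement U of its kernel stays a left inverse of
   L up to a small error, so L is injective on U; by equality of the ranks U is
   also a complement of the kernel of L. *)
Lemma lker_perturbation (L0 : 'Hom(W, X)) (v : W) (e : R) :
  v \in lker L0 -> 0 < e ->
  exists2 dl : R, 0 < dl & forall L : 'Hom(W, X),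
    \dim (limg L) = \dim (limg L0) ->
    (forall w, `|L w - L0 w| <= dl * `|w|) ->
    exists2 v', v' \in lker L & `|v - v'| <= e.
Proof.
move=> vL0 e0; pose p := projv (lker L0); pose U := lker p.
(* A preimage under [L0] is stripped of its kernel component, so that [M] inverts [L0] on [U]. *)
pose M : 'Hom(X, W) := (inv_lfun L0 - (p \o inv_lfun L0))%VF.
have ME x : M x = inv_lfun L0 x - p (inv_lfun L0 x).
  by rewrite /M add_lfunE opp_lfunE comp_lfunE.
have ML u : u \in U -> M (L0 u) = u.
  rewrite memv_ker => /eqP pu; rewrite ME.
  set y := inv_lfun L0 (L0 u).
  have : p (y - u) = y - u.
    apply: projv_id; rewrite memv_ker linearB /=.
    by rewrite limg_lfunVK ?subrr// memv_img// memvf.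
  rewrite linearB /= pu subr0 => ->; by rewrite opprB addrC subrK.
have [C C0 MC] := lfun_bounded M.
(* The first bound makes [M] after [L - L0] a contraction of factor 1/2, the second makes it at most
   [e / 2] at [v]. *)
exists (Num.min (2^-1 / C) (e / (2 * C * (1 + `|v|)))).
  rewrite lt_min !divr_gt0//; last by rewrite !mulr_gt0// ltr_pwDl.
move=> L rL LL0.
have small1 w : `|M (L w - L0 w)| <= 2^-1 * `|w|.
  apply: le_trans (MC _) _; rewrite -ler_pdivlMl//.
  apply: le_trans (LL0 w) _; rewrite mulrA ler_wpM2r// mulrC.
  by rewrite ge_min lexx.
have dimU : \dim U = \dim (limg L0).
  rewrite /U lker_proj dimv_compl.
  have := limg_ker_dim L0 fullv; rewrite capfv => <-.
  by rewrite addKn.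
have UL : (L @: U)%VS = limg L.
  apply/eqP; rewrite eqEdim limgS ?subvf//= rL -dimU limg_dim_eq//.
  apply/eqP; rewrite -subv0; apply/subvP => u; rewrite memv_cap => /andP[uU].
  rewrite memv_ker => /eqP Lu; have := small1 u.
  rewrite Lu sub0r linearN /= ML// normrN => u1.
  rewrite memv0 -normr_eq0; apply/eqP; have := normr_ge0 u.
  by move: u1; set t := `|u|; lra.
have : L v \in (L @: U)%VS by rewrite UL memv_img// memvf.
move=> /memv_imgP[u uU Lvu].
(* Here [u] lies in [U] and [L u = L v]; the identity [u = M (L v - L0 v) - M (L u - L0 u)] gives
   [|u| <= e / 2 + |u| / 2]. *)
exists (v - u); first by rewrite memv_ker linearB /= Lvu subrr.
rewrite opprB addrC subrK.
have uE : u = M (L v - L0 v) - M (L u - L0 u).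
  rewrite -linearB /= Lvu; move: vL0; rewrite memv_ker => /eqP ->.
  by rewrite subr0 opprB addrC subrK ML.
have nu : `|u| <= `|M (L v - L0 v)| + 2^-1 * `|u|.
  by rewrite {1}uE (le_trans (ler_normB _ _))// lerD2l.
have : `|M (L v - L0 v)| <= e / 2.
  apply: le_trans (MC _) _; rewrite -ler_pdivlMl//.
  apply: le_trans (LL0 v) _.
  apply: (@le_trans _ _ (e / (2 * C * (1 + `|v|)) * (1 + `|v|))).
    by apply: ler_pM => //; [rewrite le_min !divr_ge0// ?mulr_ge0// ?ltW ?addr_ge0// |rewrite ge_min lexx orbT|rewrite lerDr].
  have : 1 + `|v| != 0 by rewrite gt_eqF// ltr_pwDl.
  move=> v0; rewrite le_eqVlt; apply/orP; left; apply/eqP; field.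
  by rewrite v0 gt_eqF.
move: nu; set t := `|u|; set s := `|_|; lra.
Qed.

End kernel_perturbation.

Section afree.
Variables (R : realType) (d k : nat) (W X : finInnerType R).
Variable Aop : multi_index d k -> 'Hom(W, X).
Hypothesis Aop_rank : constant_rank Aop.
Local Notation rV := 'rV[R]_d.

Lemma symbolE xi w : symbol Aop xi w =
  \sum_(alpha : multi_index d k)
    (\prod_i xi ord0 i ^+ val alpha i) *: Aop alpha w.
Proof. by rewrite /symbol sum_lfunE; apply: eq_bigr => a _; rewrite scale_lfunE. Qed.

Lemma symbolZ a xi w : symbol Aop (a *: xi) w = a ^+ k *: symbol Aop xi w.
Proof.
rewrite !symbolE scaler_sumr; apply: eq_bigr => al _; rewrite scalerA.
congr (_ *: _); under eq_bigr do rewrite mxE exprMn.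
rewrite big_split /=; congr (_ * _); rewrite prodrXr.
by rewrite (eqP (valP al)).
Qed.

Lemma lker_symbolZ a xi : a != 0 ->
  lker (symbol Aop (a *: xi)) = lker (symbol Aop xi).
Proof.
move=> a0; apply/vspaceP => w; rewrite !memv_ker symbolZ scaler_eq0.
by rewrite expf_eq0 (negbTE a0) andbF.
Qed.

(** By homogeneity the kernel at [z + N y] is the kernel at [y + z / N], which tends to [y]; the
    symbol is continuous in the frequency, and constant rank turns closeness of symbols into
    closeness of kernels. *)
Lemma lker_symbol_dilated z y v e : y != 0 -> v \in lker (symbol Aop y) -> 0 < e ->
  \forall N \near +oo,
    exists2 v', v' \in lker (symbol Aop (z + N *: y)) & `|v - v'| <= e.
Proof.
move=> y0 vy e0.
have [dl dl0 dlP] := lker_perturbation vy e0.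
have [r _ rP] := Aop_rank.
have /choice[C CP] (al : multi_index d k) :
    exists C : R, 0 < C /\ forall w, `|Aop al w| <= C * `|w|.
  by have [C C0 CP] := lfun_bounded (Aop al); exists C.
pose mon (al : multi_index d k) (xi : rV) : R := \prod_i xi ord0 i ^+ val al i.
have mon_cont al : continuous (mon al).
  apply: continuous_big => [|i _ x]; first exact: mul_continuous.
  exact: (continuous_comp (@coord_continuous _ _ _ _ _ _) (@exprn_continuous _ _ _)).
pose g xi := \sum_(al : multi_index d k) `|mon al xi - mon al y| * C al.
have gc : continuous g.
  apply: continuous_big => [|i _ x]; first exact: add_continuous.
  apply: (@cvgMr_tmp _ _ (nbhs x) _ (fun x => `|mon i x - mon i y|)).
  apply: (@cvg_norm _ _ _ (nbhs x) _ (fun x => mon i x - mon i y)); apply: cvgB; last exact: cvg_cst.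
  exact: mon_cont.
have gy : g y = 0.
  by rewrite /g big1// => al _; rewrite subrr normr0 mul0r.
have cN : (y + N^-1 *: z : rV) @[N --> +oo] --> y.
  rewrite -[X in _ --> X]addr0; apply: cvgD; first exact: cvg_cst.
  rewrite -(scale0r z); apply: cvgZr_tmp.
  apply/gtr0_cvgV0; last exact: cvg_id.
  exact: nbhs_pinfty_gt.
have gN : g (y + N^-1 *: z) @[N --> +oo] --> 0.
  rewrite -gy; apply: cvg_comp cN _; exact: gc.
near=> N.
have N0 : 0 < N by near: N; exact: nbhs_pinfty_gt.
have zN0 : z + N *: y != 0.
  by near: N; exact: dilated_frequency_neq0.
have zE : z + N *: y = N *: (y + N^-1 *: z).
  by rewrite scalerDr scalerA mulfV ?gt_eqF// scale1r addrC.
have yz0 : y + N^-1 *: z != 0.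
  by apply: contraNneq zN0; rewrite zE => ->; rewrite scaler0.
rewrite zE lker_symbolZ ?gt_eqF//.
apply: dlP; first by rewrite !rP.
move=> w; rewrite !symbolE -sumrB.
apply: le_trans (ler_norm_sum _ _ _) _.
apply: (@le_trans _ _ (g (y + N^-1 *: z) * `|w|)).
  rewrite mulr_suml ler_sum// => al _; rewrite -scalerBl normrZ -mulrA.
  by rewrite ler_wpM2l//; have [] := CP al.
rewrite ler_wpM2r//; apply: le_trans (ler_norm _) _; apply: ltW.
rewrite -[X in `|X|]subr0 distrC.
near: N; by move/cvgrPdist_lt: gN; apply.
Unshelve. all: by end_near. Qed.

End afree.

(** * A-free trigonometric fields *)

Section afree_fields.
Variables (R : realType) (d k : nat) (W X : finInnerType R).
Variable Aop : multi_index d k -> 'Hom(W, X).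
Local Notation rV := 'rV[R]_d.
Implicit Types (Y Z : rV -> W) (u : rV -> R).

(** Being A-free is encoded amplitude by amplitude on the Fourier side; the differential operator
    itself enters only in [diffop_waves]. Nonzero frequencies make the mean vanish and are what
    [lker_symbol_dilated] asks for. *)
Definition is_afree Y := exists2 l : seq (W * rV),
  forall p, p \in l -> p.2 != 0 /\ p.1 \in lker (symbol Aop p.2) &
  forall x, Y x = \sum_(p <- l) cos (dot p.2 x) *: p.1.

Lemma is_afree_ext Y Z : Y =1 Z -> is_afree Y -> is_afree Z.
Proof. by move=> YZ [l lP Yl]; exists l => // x; rewrite -YZ. Qed.

Lemma is_afree0 : is_afree (fun=> 0).
Proof. by exists [::] => // x; rewrite big_nil. Qed.

Lemma is_afree_cos z v : z != 0 -> v \in lker (symbol Aop z) ->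
  is_afree (fun x => cos (dot z x) *: v).
Proof.
move=> z0 vz; exists [:: (v, z)]; last by move=> x; rewrite big_seq1.
by move=> p; rewrite inE => /eqP ->.
Qed.

Lemma is_afreeD Y Z : is_afree Y -> is_afree Z -> is_afree (Y \+ Z).
Proof.
move=> [l lP Yl] [m mP Zm]; exists (l ++ m).
  by move=> p; rewrite mem_cat => /orP[/lP|/mP].
by move=> x; rewrite big_cat /= Yl Zm.
Qed.

Lemma is_afreeZ a Y : is_afree Y -> is_afree (fun x => a *: Y x).
Proof.
move=> [l lP Yl]; exists [seq (a *: p.1, p.2) | p <- l].
  move=> p /mapP[q /lP[q0 qk] ->]; split=> //=.
  by apply: memvZ.
move=> x; rewrite Yl big_map scaler_sumr; apply: eq_bigr => p _ /=.
by rewrite !scalerA mulrC.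
Qed.

Lemma is_afree_ind (Q : (rV -> W) -> Prop) Y :
  is_afree Y ->
  (forall Y Z, Y =1 Z -> Q Y -> Q Z) -> Q (fun=> 0) ->
  (forall z v, z != 0 -> v \in lker (symbol Aop z) ->
     Q (fun x => cos (dot z x) *: v)) ->
  (forall Y Z, Q Y -> Q Z -> Q (Y \+ Z)) ->
  Q Y.
Proof.
move=> [l lP Yl] Qe Q0 Qc QD; apply: (Qe _ _ (fsym Yl)).
elim: l lP {Y Yl} => [_|[v z] l IH lP].
  by apply: Qe Q0 => x; rewrite big_nil.
have [z0 vz] := lP (v, z) (mem_head _ _).
have Ql : Q (fun x => \sum_(p <- l) cos (dot p.2 x) *: p.1).
  by apply: IH => p pl; apply: lP; rewrite inE pl orbT.
by apply: Qe (QD _ _ (Qc _ _ z0 vz) Ql) => x; rewrite big_cons.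
Qed.

Hypothesis Aop_rank : constant_rank Aop.

(* The product of a slow scalar with a fast A-free field has all its frequencies
   close in direction to those of the fast field, so it is nearly A-free. *)
Lemma is_afree_modulate u m Y e : is_trig u m -> is_afree Y -> 0 < e ->
  \forall N \near +oo, exists2 Z, is_afree Z &
    forall x, `|Z x - u x *: Y (N *: x)| <= e.
Proof.
move=> tu aY; move: e.
apply: (is_trig_ind (Q := fun u m => forall e, 0 < e ->
  \forall N \near +oo, exists2 Z, is_afree Z &
    forall x, `|Z x - u x *: Y (N *: x)| <= e) tu) => {u m tu}.
- move=> u w _ uw Hu e /Hu; apply: filterS => N [Z aZ ZP].
  by exists Z => // x; rewrite -uw.
- move=> e e0; near=> N; exists (fun=> 0); first exact: is_afree0.
  by move=> x; rewrite scale0r subrr normr0 ltW.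
- move=> a z.
  apply: (is_afree_ind (Q := fun Y => forall e, 0 < e ->
  \forall N \near +oo, exists2 Z, is_afree Z &
    forall x, `|Z x - (a * cos (dot z x)) *: Y (N *: x)| <= e) aY) => {Y aY}.
  + move=> Y V YV HY e /HY; apply: filterS => N [Z aZ ZP].
    by exists Z => // x; rewrite -YV.
  + move=> e e0; near=> N; exists (fun=> 0); first exact: is_afree0.
    by move=> x; rewrite scaler0 subrr normr0 ltW.
  + move=> y v y0 vy e e0.
    have Ny0 : - y != 0 by rewrite oppr_eq0.
    (* The product formula for cosines produces both [z + N y] and [z - N y]. *)
    have vNy : v \in lker (symbol Aop (- y)).
      by rewrite -scaleN1r lker_symbolZ// oppr_eq0 oner_eq0.
    pose e' := e / (1 + `|a|).
    have a1 : 0 < 1 + `|a| by rewrite ltr_pwDl.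
    have e'0 : 0 < e' by rewrite divr_gt0.
    near=> N.
    have zy : z + N *: y != 0 by near: N; exact: dilated_frequency_neq0.
    have zNy : z + N *: - y != 0 by near: N; exact: dilated_frequency_neq0.
    have [v1 v1k v1P] : exists2 v', v' \in lker (symbol Aop (z + N *: y)) & `|v - v'| <= e'.
      by near: N; exact: lker_symbol_dilated.
    have [v2 v2k v2P] : exists2 v', v' \in lker (symbol Aop (z + N *: - y)) & `|v - v'| <= e'.
      by near: N; exact: lker_symbol_dilated.
    exists ((fun x => (a / 2) *: (cos (dot (z + N *: y) x) *: v1)) \+
            (fun x => (a / 2) *: (cos (dot (z + N *: - y) x) *: v2))).
      by apply: is_afreeD; apply: is_afreeZ; exact: is_afree_cos.
    move=> x /=.
    have -> : (a * cos (dot z x)) *: (cos (dot y (N *: x)) *: v) =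
      (a / 2) *: (cos (dot (z + N *: y) x) *: v) +
      (a / 2) *: (cos (dot (z + N *: - y) x) *: v).
      rewrite !scalerA -scalerDl; congr (_ *: _).
      by rewrite -mulrA !dotDl !dotZl dotNl dotZr mulrN cosM; field.
    rewrite opprD addrACA -!scalerBr -[v1 - v]opprB -[v2 - v]opprB.
    have E (b : R) (w : W) : `|cos b *: - w| <= `|w|.
      by rewrite normrZ normrN ler_piMl// ler_norml cos_geN1 cos_le1.
    rewrite -scalerDr normrZ.
    apply: (@le_trans _ _ (`|a / 2| * (e' + e'))).
      rewrite ler_wpM2l// (le_trans (ler_normD _ _))// lerD//.
        exact: le_trans (E _ _) v1P.
      exact: le_trans (E _ _) v2P.
    rewrite normrM [`|2^-1|]ger0_norm// -mulrA (_ : _ * (e' + e') = e'); last by field.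
    by rewrite mulrC /e' mulrAC ler_pdivrMr// ler_wpM2l ?lerDr// ltW.
  + move=> Y V HY HV e e0; have e2 : 0 < e / 2 by rewrite divr_gt0.
    have := HV _ e2; have := HY _ e2; apply: filterS2 => N [Z1 a1 P1] [Z2 a2 P2].
    exists (Z1 \+ Z2); first exact: is_afreeD.
    move=> x /=; rewrite scalerDr opprD addrACA.
    by rewrite (le_trans (ler_normD _ _))// [leRHS](splitr e) lerD.
- move=> v w _ _ Hv Hw e e0; have e2 : 0 < e / 2 by rewrite divr_gt0.
  have := Hw _ e2; have := Hv _ e2; apply: filterS2 => N [Z1 a1 P1] [Z2 a2 P2].
  exists (Z1 \+ Z2); first exact: is_afreeD.
  move=> x /=; rewrite scalerDl opprD addrACA.
  by rewrite (le_trans (ler_normD _ _))// [leRHS](splitr e) lerD.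
Unshelve. all: by end_near. Qed.

(* H ^ 2 is a product of dilates of (2 / 3) (1 + cos) ^ 2: it has mean 1 while
   the mean of H is (2 / 3) to the power n / 2, so that H ^ 2 concentrates. *)
Lemma concentrating_kernel xi v dl : xi != 0 -> v \in lker (symbol Aop xi) ->
  0 < dl -> forall e, 0 < e ->
  exists H : rV -> R, exists h, [/\ forall x, 0 <= H x, is_trig H h, 0 <= h <= dl,
    is_trig (fun x => H x ^+ 2) 1 &
    exists2 Z, is_afree Z & forall x, `|Z x - (H x ^+ 2 - 1) *: v| <= e].
Proof.
move=> xi0 vxi dl0.
(* The mean of [(1 + cos) ^ 2] is 3/2, which fixes the normalisation of [g ^ 2]; the mean of [g] is
   then [c < 1]. *)
pose c : R := Num.sqrt (2 / 3).
have c0 : 0 <= c by rewrite sqrtr_ge0.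
have c2 : c ^+ 2 = 2 / 3 by rewrite sqr_sqrtr// divr_ge0.
have c1 : c < 1.
  by rewrite -(@ltr_pXn2r _ 2)// ?nnegrE// c2 expr1n; lra.
pose g (x : rV) := c * (1 + cos (dot xi x)).
have g0 x : 0 <= g x.
  by rewrite mulr_ge0// -lerBlDl sub0r cos_geN1.
have tg : is_trig g c.
  have := is_trigZ c (is_trigD (is_trig_cst d 1) (is_trig_cos 1 xi)).
  rewrite (negbTE xi0) addr0 mulr1; apply: is_trig_ext => x.
  by rewrite /= mul1r.
have xi20 : 2 *: xi != 0 by rewrite scaler_eq0 negb_or xi0 andbT pnatr_eq0.
have g2E x : g x ^+ 2 = 1 + 4 / 3 * cos (dot xi x) + 3^-1 * cos (dot (2 *: xi) x).
  rewrite /g exprMn c2 dotZl (_ : 2 * dot xi x = dot xi x + dot xi x); last by ring.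
  by rewrite cosD -!expr2 sin2cos2; field.
have tg2 : is_trig (fun x => g x ^+ 2) 1.
  have := is_trigD (is_trigD (is_trig_cst d 1) (is_trig_cos (4/3) xi)) (is_trig_cos (3^-1) (2 *: xi)).
  rewrite (negbTE xi0) (negbTE xi20) !addr0; apply: is_trig_ext => x.
  by rewrite g2E.
(* Only the frequencies [xi] and [2 xi] occur, and both kernels contain [v]. *)
have ag : is_afree (fun x => (g x ^+ 2 - 1) *: v).
  have vxi2 : v \in lker (symbol Aop (2 *: xi)) by rewrite lker_symbolZ// pnatr_eq0.
  have := is_afreeD (is_afreeZ (4/3) (is_afree_cos xi0 vxi)) (is_afreeZ (3^-1) (is_afree_cos xi20 vxi2)).
  apply: is_afree_ext => x /=; rewrite !scalerA -scalerDl g2E; congr (_ *: _).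
  by ring.
suff main n : forall e, 0 < e -> exists H : rV -> R,
    [/\ forall x, 0 <= H x, is_trig H (c ^+ n),
    is_trig (fun x => H x ^+ 2) 1 &
    exists2 Z, is_afree Z & forall x, `|Z x - (H x ^+ 2 - 1) *: v| <= e].
  move=> e e0.
  have [n cn] : exists n, c ^+ n <= dl.
    have /cvgrPdist_le/(_ _ dl0)[n _ /(_ n)] : c ^+ n @[n --> \oo] --> 0.
      by apply: cvg_expr; rewrite ger0_norm.
    rewrite /= leqnn sub0r normrN ger0_norm ?exprn_ge0// => /(_ isT) cn.
    by exists n.
  have [H [H0 H1 H2 H3]] := main n e e0.
  by exists H, (c ^+ n); split; rewrite ?exprn_ge0.
elim: n => [|n IH] e e0.
  exists (fun=> 1); split=> //; first by rewrite expr0; exact: is_trig_cst.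
    by apply: is_trig_ext (is_trig_cst d 1) => x; rewrite expr1n.
  exists (fun=> 0); first exact: is_afree0.
  by move=> x; rewrite expr1n subrr scale0r subrr normr0 ltW.
have e2 : 0 < e / 2 by rewrite divr_gt0.
have [H [H0 H1 H2 [Z aZ ZP]]] := IH _ e2.
near (pinfty_nbhs R) => N.
exists (fun x => H x * g (N *: x)); split.
- by move=> x; rewrite mulr_ge0.
- by rewrite exprSr; near: N; exact: is_trigM_dilate.
- have : is_trig (fun x => H x ^+ 2 * g (N *: x) ^+ 2) (1 * 1).
    by near: N; exact: (is_trigM_dilate H2 tg2).
  by rewrite mulr1; apply: is_trig_ext => x; rewrite [RHS]exprMn.
- have [Z' aZ' Z'P] : exists2 Z', is_afree Z' &
    forall x, `|Z' x - H x ^+ 2 *: ((g (N *: x) ^+ 2 - 1) *: v)| <= e / 2.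
    by near: N; exact: (is_afree_modulate H2 ag).
  exists (Z \+ Z'); first exact: is_afreeD.
  move=> x /=.
  (* A martingale increment: the earlier [H ^ 2] slowly modulates the fast mean-zero field
     [(g ^ 2 - 1) v]. *)
  have -> : ((H x * g (N *: x)) ^+ 2 - 1) *: v =
    (H x ^+ 2 - 1) *: v + H x ^+ 2 *: ((g (N *: x) ^+ 2 - 1) *: v).
    by rewrite scalerA -scalerDl; congr (_ *: _); ring.
  rewrite opprD addrACA (le_trans (ler_normD _ _))//.
  by rewrite [leRHS](splitr e) lerD.
Unshelve. all: by end_near. Qed.

End afree_fields.

(** * Concentration along the span of the wave cone *)

(** Reduces vector identities to scalar ones in each coordinate, where [ring] applies. *)
Lemma coord_ext (R : realType) (W : finInnerType R) (u v : W) :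
  (forall i, coord (vbasis {: W}) i u = coord (vbasis {: W}) i v) -> u = v.
Proof.
move=> uv; rewrite (coord_vbasis (memvf u)) (coord_vbasis (memvf v)).
by apply: eq_bigr => i _; rewrite uv.
Qed.

(** * Elementary inequalities for truncated and nearly disjoint quantities *)

Section real_inequalities.
Variable R : realType.
Implicit Types a b h x y : R.

(** The minimum is at most the geometric mean [sqrt (a b) h] of its two arguments. *)
Lemma double_min_sqr_le a b h : 0 <= a -> 0 <= b -> 0 <= h ->
  2 * Num.min a (b * h ^+ 2) <= (a + b) * h.
Proof.
move=> a0 b0 h0; set t := Num.min _ _.
have t0 : 0 <= t by rewrite le_min a0 mulr_ge0// exprn_ge0.
have ta : t <= a by rewrite ge_min lexx.
have tb : t <= b * h ^+ 2 by rewrite ge_min lexx orbT.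
rewrite -(@ler_pXn2r _ 2)// ?nnegrE ?mulr_ge0// ?addr_ge0//.
have : t ^+ 2 <= a * (b * h ^+ 2) by rewrite expr2; exact: ler_pM.
have : 0 <= ((a - b) * h) ^+ 2 by exact: sqr_ge0.
rewrite !exprMn sqrrB sqrrD; lra.
Qed.

(** Quantifies almost disjoint supports: wherever one term is negligible, absolute values add. *)
Lemma normD_double_min x y :
  `| `|x + y| - `|x| - `|y| | <= 2 * Num.min `|x| `|y|.
Proof.
rewrite ler_norml minElt.
have := ler_normD x y; have := lerB_dist x (- y); have := lerB_dist y (- x).
rewrite !opprK !normrN [y + x]addrC.
by case: ltP; set a := `|x|; set b := `|y|; set c := `|_|; move=> *; apply/andP; split; lra.
Qed.

Lemma norm_subsqr_le a b : 0 <= a -> 0 <= b ->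
  `| `|a ^+ 2 - b ^+ 2| - (a ^+ 2 + b ^+ 2)| <= 2 * (a * b).
Proof.
move=> a0 b0; have := normD_double_min (a ^+ 2) (- b ^+ 2).
rewrite normrN (ger0_norm (sqr_ge0 a)) (ger0_norm (sqr_ge0 b)).
rewrite -addrA -opprD => H.
apply: le_trans H _.
rewrite ler_pM2l// ge_min.
case: (leP a b) => ab; apply/orP; [left|right]; rewrite expr2.
  by rewrite ler_wpM2l.
by rewrite ler_wpM2r// ltW.
Qed.

End real_inequalities.

Section two_sided_concentration.
Variables (R : realType) (d k : nat) (W X : finInnerType R).
Variable Aop : multi_index d k -> 'Hom(W, X).
Hypothesis Aop_rank : constant_rank Aop.
Local Notation rV := 'rV[R]_d.

(* Up to errors that are small in mean, Y is an A-free field with values in the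
   line spanned by A; kap is a trigonometric polynomial replacing |y|. *)
Definition two_sided (A : W) := forall e : R, 0 < e ->
  exists Y, exists y, exists kap, exists rho : rV -> R, exists r : R,
  [/\ is_afree Aop Y, is_trig y 0, is_trig kap 1, is_trig rho r & r <= e] /\
  forall x, `|Y x - y x *: A| <= rho x /\ `| `|y x| - kap x| <= rho x.

(** Half the difference of two independent concentrating squares has mean 0, and its modulus is
    nearly half their sum, of mean 1. The error [H H(N x)] has mean [h * h], at most [e] because
    [h <= 1] and [h <= e]. *)
Lemma two_sided0 (xi : rV) : xi != 0 -> two_sided 0.
Proof.
move=> xi0 e e0.
have em : 0 < Num.min 1 e by rewrite lt_min ltr01.
have [H [h [H0 H1 hd H2 _]]] :=
  concentrating_kernel Aop_rank xi0 (mem0v _) em ltr01.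
near (pinfty_nbhs R) => N.
exists (fun=> 0), (fun x => 2^-1 * (H x ^+ 2 - H (N *: x) ^+ 2)),
  (fun x => 2^-1 * (H x ^+ 2 + H (N *: x) ^+ 2)), (fun x => H x * H (N *: x)), (h * h).
have H2N : is_trig (fun x => H (N *: x) ^+ 2) 1.
  by near: N; exact: (is_trig_dilate H2).
split.
  split.
  - exact: is_afree0.
  - by rewrite -(mulr0 2^-1) -(subrr 1); apply/is_trigZ/is_trigB.
  - by apply: is_trig_eqm (is_trigZ _ (is_trigD H2 H2N)); rewrite mulVf.
  - by near: N; exact: is_trigM_dilate.
  - move/andP : hd => [h0]; rewrite le_min => /andP[h1 he].
    by rewrite (le_trans _ he)// ler_piMl.
move=> x; rewrite scaler0 subrr normr0 mulr_ge0//; split=> //.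
rewrite normrM ger0_norm// -mulrBr normrM ger0_norm//.
by rewrite ler_pdivrMl// norm_subsqr_le.
Unshelve. all: by end_near. Qed.

(** * The staircase laminate *)

Section staircase.
Variables (A v : W) (s e eta : R) (y kap rho : rV -> R) (Y : rV -> W) (r : R) (xi : rV).
Hypotheses (s0 : 0 < s) (eta0 : 0 < eta) (ys : forall x, `|y x| <= s).
Hypotheses (xi0 : xi != 0) (vxi : v \in lker (symbol Aop xi)).
Hypotheses (aY : is_afree Aop Y) (ty : is_trig y 0) (tk : is_trig kap 1).
Hypotheses (trho : is_trig rho r) (re : r <= e).
Hypothesis Yy : forall x, `|Y x - y x *: A| <= rho x.
Hypothesis yk : forall x, `| `|y x| - kap x| <= rho x.

(* One round adds the rescaled field P Y in direction A at the weight P of the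
   current state s P v, which the concentrating kernel then moves to
   P (y v + (s - y) H^2 v): where H is small this is P y v, completing
   P y A to P y (A + v), and the rare large values become the next state. *)
Lemma staircase m : exists Z, exists S, exists P, exists K, exists rh,
  exists tau : rV -> R, exists q t : R,
  [/\ is_afree Aop Z, is_trig S 0, is_trig P 1 & is_trig K m%:R] /\
  [/\ is_trig rh q, q <= m%:R * (e + 2 * eta), is_trig tau t & t <= eta] /\
  forall x, [/\ 0 <= P x,
    `|Z x - S x *: (A + v) - (s * (P x - 1)) *: v| <= rh x,
    `| `|S x| - K x| <= rh x &
    2 * Num.min `|S x| (s * P x) <= tau x].
Proof.
elim: m => [|m [Z [S [P [K [rh [tau [q [t]]]]]]]]].
  exists (fun=> 0), (fun=> 0), (fun=> 1), (fun=> 0), (fun=> 0), (fun=> 0), 0, 0.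
  split; [split|split; [split|]]; rewrite ?mul0r//; try exact: is_trig_cst.
  - exact: is_afree0.
  - exact: ltW.
  - move=> x /=; rewrite subrr mulr0 !scale0r !subr0 !normr0.
    split=> //; rewrite (_ : Num.min 0 _ = 0) ?mulr0//.
    by apply/min_idPl; rewrite mulr1 ltW.
move=> [[aZ tS tP tK] [[trh qe ttau te] inv]].
near (pinfty_nbhs R) => N.
have [Z1 aZ1 Z1P] : exists2 Z1, is_afree Aop Z1 &
    forall x, `|Z1 x - P x *: Y (N *: x)| <= eta / 3.
  by near: N; apply: (is_afree_modulate Aop_rank tP aY); rewrite divr_gt0.
pose S' x := S x + P x * y (N *: x).
have tPy : is_trig (fun x => P x * y (N *: x)) 0.
  by rewrite -(mulr0 1); near: N; exact: is_trigM_dilate.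
have tS' : is_trig S' 0 by rewrite -(addr0 0); exact: (is_trigD tS tPy).
(* The amplitude that is moved in direction [v]. The bound [|y| <= s] keeps it nonnegative, and its
   mean is [s] because [P y] has mean 0. *)
pose b x := s * P x - P x * y (N *: x).
have tb : is_trig b s.
  by rewrite -(subr0 s) -{1}(mulr1 s); apply: (is_trigB (is_trigZ s tP) tPy).
have b0 x : 0 <= b x.
  rewrite /b mulrC -mulrBr mulr_ge0//; first by have [] := inv x.
  by rewrite subr_ge0 (le_trans _ (ys (N *: x)))// ler_norm.
(* The kernel is chosen after [S'] and [b], since its mean has to beat their suprema: [(C1 + C2) H]
   gets mean at most [eta], and [b] times the A-free error of the kernel stays below [eta / 3]. *)
have [C1 C10 SC] := is_trig_bounded tS'.
have [C2 C20 bC] := is_trig_bounded tb.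
have C120 : 0 < C1 + C2 by rewrite addr_gt0.
have dl0 : 0 < eta / (C1 + C2) by rewrite divr_gt0.
have eK0 : 0 < eta / (3 * C2) by rewrite divr_gt0// mulr_gt0.
have [H [h [H0 tH /andP[h0 hd] tH2 [ZK aZK ZKP]]]] :=
  concentrating_kernel Aop_rank xi0 vxi dl0 eK0.
near (pinfty_nbhs R) => M.
have [Z2 aZ2 Z2P] : exists2 Z2, is_afree Aop Z2 &
    forall x, `|Z2 x - b x *: ZK (M *: x)| <= eta / 3.
  by near: M; apply: (is_afree_modulate Aop_rank tb aZK); rewrite divr_gt0.
(* The error gains [P rho], of mean [r], from the rescaled field, three times [eta / 3] from the
   A-free corrections, and [tau] from the overlap of [S] with the current state. *)
exists (Z \+ Z1 \+ Z2), S', (fun x => s^-1 * (b x * H (M *: x) ^+ 2)),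
  (fun x => K x + P x * kap (N *: x)),
  (fun x => rh x + P x * rho (N *: x) + eta + tau x),
  (fun x => (C1 + C2) * H (M *: x)), (q + r + eta + t), ((C1 + C2) * h).
split; [split=> //|split; [split|]].
- by do 2!apply: is_afreeD => //.
- have tbH : is_trig (fun x => b x * H (M *: x) ^+ 2) (s * 1).
    by near: M; exact: (is_trigM_dilate tb tH2).
  by apply: is_trig_eqm (is_trigZ _ tbH); rewrite mulr1 mulVf ?gt_eqF.
- rewrite -natr1; apply: (is_trigD tK).
  by rewrite -(mulr1 1); near: N; exact: is_trigM_dilate.
- apply: (is_trigD (is_trigD (is_trigD trh _) (is_trig_cst d eta)) ttau).
  by rewrite -(mul1r r); near: N; exact: is_trigM_dilate.
- rewrite -natr1 mulrDl mul1r; move: qe re te.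
  by set B := m%:R * _; lra.
- by apply: is_trigZ; near: M; exact: is_trig_dilate.
- by rewrite mulrC -ler_pdivlMr.
move=> x; have [P0 i1 i2 i3] := inv x.
have sP : s * (s^-1 * (b x * H (M *: x) ^+ 2)) = b x * H (M *: x) ^+ 2.
  by rewrite mulrA mulfV ?mul1r ?gt_eqF.
have tau0 : 0 <= tau x.
  by apply: le_trans i3; rewrite mulr_ge0// le_min normr_ge0 mulr_ge0// ltW.
have rho0 z : 0 <= rho z by apply: le_trans (Yy z).
split.
- by rewrite !mulr_ge0// ?exprn_ge0// invr_ge0 ltW.
- set e1 := Z x - _ - _ in i1.
  (* The term [s P v] of the old state cancels against the one in [b v], which leaves [P y v]. *)
  have -> : (Z \+ Z1 \+ Z2) x - S' x *: (A + v) -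
      (s * (s^-1 * (b x * H (M *: x) ^+ 2) - 1)) *: v =
      e1 + (Z1 x - P x *: Y (N *: x)) + P x *: (Y (N *: x) - y (N *: x) *: A) +
      (Z2 x - b x *: ZK (M *: x)) +
      b x *: (ZK (M *: x) - (H (M *: x) ^+ 2 - 1) *: v).
    rewrite mulrBr sP /e1 /S' /b /=; apply: coord_ext => i.
    rewrite !(linearB, linearD, linearZ) /= /GRing.scale /=; ring.
  have -> : rh x + P x * rho (N *: x) + eta + tau x = rh x + eta / 3 +
     P x * rho (N *: x) + eta / 3 + eta / 3 + tau x by field.
  rewrite -[leLHS]addr0 lerD//.
  have nP : `|P x *: (Y (N *: x) - y (N *: x) *: A)| <= P x * rho (N *: x).
    by rewrite normrZ ger0_norm// ler_wpM2l.
  have nb : `|b x *: (ZK (M *: x) - (H (M *: x) ^+ 2 - 1) *: v)| <= eta / 3.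
    rewrite normrZ ger0_norm//; apply: (@le_trans _ _ (C2 * (eta / (3 * C2)))).
      by apply: ler_pM => //; apply: le_trans (bC x); exact: ler_norm.
    have C2n : C2 != 0 by rewrite gt_eqF.
    by rewrite le_eqVlt; apply/orP; left; apply/eqP; field.
  apply: le_trans (ler_normD _ _) (lerD _ nb).
  apply: le_trans (ler_normD _ _) (lerD _ (Z2P _)).
  apply: le_trans (ler_normD _ _) (lerD _ nP).
  exact: le_trans (ler_normD _ _) (lerD i1 (Z1P _)).
- rewrite /S'; set p := P x * y _.
  (* Absolute values are added across nearly disjoint supports: since [|P y| <= s P], the invariant
     on [tau] pays for the overlap. *)
  have -> : `|S x + p| - (K x + P x * kap (N *: x)) =
    (`|S x + p| - `|S x| - `|p|) + (`|S x| - K x) +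
    P x * (`|y (N *: x)| - kap (N *: x)).
    by rewrite /p normrM (ger0_norm P0); ring.
  have : `| `|S x + p| - `|S x| - `|p| | <= tau x.
    apply: le_trans (normD_double_min _ _) (le_trans _ i3).
    rewrite ler_pM2l// le_min !ge_min lexx /= /p normrM (ger0_norm P0) mulrC.
    by rewrite ler_wpM2l ?orbT.
  have : `|P x * (`|y (N *: x)| - kap (N *: x))| <= P x * rho (N *: x).
    by rewrite normrM ger0_norm// ler_wpM2l.
  have := ler_normD (`|S x + p| - `|S x| - `|p| + (`|S x| - K x)) (P x * (`|y (N *: x)| - kap (N *: x))).
  have := ler_normD (`|S x + p| - `|S x| - `|p|) (`|S x| - K x).
  move: i2 eta0; lra.
- rewrite sP; apply: le_trans (double_min_sqr_le (normr_ge0 _) (b0 x) (H0 _)) _.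
  rewrite ler_wpM2r// lerD//.
  by apply: le_trans (bC x); exact: ler_norm.
Unshelve. all: by end_near. Qed.

End staircase.

(** After [m] rounds the unwanted part [s (P - 1) v] is at most [s |v| (P + 1)], of mean [2 s |v|]
    whatever [m] is, while [K] has mean [m]. Dividing by [m] normalises the field and makes this
    remainder small. *)
Lemma two_sidedD (A v : W) xi : xi != 0 -> v \in lker (symbol Aop xi) ->
  two_sided A -> two_sided (A + v).
Proof.
move=> xi0 vxi HA e e0.
have e4 : 0 < e / 4 by rewrite divr_gt0.
have e8 : 0 < e / 8 by rewrite divr_gt0.
have [Y [y [kap [rho [r [[aY ty tk trho re] Yyk]]]]]] := HA _ e4.
have [s s0 ys] := is_trig_bounded ty.
(* Chosen so that [2 s |v| / m <= e / 2]; the staircase error divided by [m] is at most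
   [e / 4 + 2 (e / 8) = e / 2]. *)
pose m := (Num.truncn (4 * s * `|v| / e)).+1.
have m0 : 0 < m%:R :> R by rewrite ltr0n.
have mv : 4 * s * `|v| / e <= m%:R by apply: ltW; exact: truncnS_gt.
have [Z [S [P [K [rh [tau [q [t [[aZ tS tP tK] [[trh qe _ _] inv]]]]]]]]]] :=
  staircase s0 e8 ys xi0 vxi aY ty tk trho re (fun x => (Yyk x).1) (fun x => (Yyk x).2) m.
exists (fun x => m%:R^-1 *: Z x), (fun x => m%:R^-1 * S x), (fun x => m%:R^-1 * K x),
 (fun x => m%:R^-1 * (rh x + s * `|v| * (P x + 1))), (m%:R^-1 * (q + s * `|v| * (1 + 1))).
split; first split.
- exact: is_afreeZ.
- by rewrite -(mulr0 m%:R^-1); exact: is_trigZ.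
- by apply: is_trig_eqm (is_trigZ _ tK); rewrite mulVf ?gt_eqF.
- apply: is_trigZ; apply: (is_trigD trh); apply: is_trigZ.
  exact: (is_trigD tP (is_trig_cst d 1)).
- rewrite ler_pdivrMl//; move: mv; rewrite ler_pdivrMr//.
  move: qe; nra.
move=> x; have [P0 i1 i2 _] := inv x.
have sv0 : 0 <= s * `|v| * (P x + 1) by rewrite !mulr_ge0 ?addr_ge0// ltW.
split.
  rewrite -scalerA -scalerBr normrZ ger0_norm ?invr_ge0 ?ler0n//.
  rewrite ler_pM2l ?invr_gt0//.
  rewrite -[X in `|X|](subrK ((s * (P x - 1)) *: v)).
  rewrite (le_trans (ler_normD _ _))// lerD//.
  rewrite normrZ mulrAC ler_wpM2r// normrM (gtr0_norm s0) ler_wpM2l ?(ltW s0)//.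
  by rewrite (le_trans (ler_normB _ _))// ger0_norm// normr1.
rewrite normrM gtr0_norm ?invr_gt0// -mulrBr normrM gtr0_norm ?invr_gt0//.
rewrite ler_pM2l ?invr_gt0//; rewrite (le_trans i2)// lerDl//.
Qed.

Lemma two_sided_span (A : W) : A != 0 -> linear_span (wave_cone Aop) A -> two_sided A.
Proof.
move=> A0 [n [c [v [vP AE]]]].
(* Since [A != 0], the sum is not empty, and its first term supplies a nonzero frequency for the
   base of the induction. *)
case: n => [|n] in c v vP AE.
  by rewrite AE big_ord0 eqxx in A0.
have [xi xi0 _] := vP ord0.
rewrite {A0}AE; elim/big_rec : _ => [|i B _ HB]; first exact: two_sided0 xi0.
have [z z0 vz] := vP i; rewrite addrC; apply: two_sidedD z0 _ HB.
exact: memvZ.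
Qed.

(** [two_sided] controls the mean of |y| but not where its mass sits. The slow factor [H ^ 2]
    localises it: [min (1, |y| H ^ 2)] is at most [(1 + s) H / 2], of small mean. *)
Lemma concentrating_fields (A : W) (xi : rV) e : xi != 0 -> two_sided A -> 0 < e ->
  exists Z, exists q, exists b, exists rho : rV -> R, exists r : R,
  [/\ is_afree Aop Z, is_trig q 0, is_trig b 1, is_trig rho r & r <= e] /\
  forall x, [/\ `|Z x - q x *: A| <= rho x, `| `|q x| - b x| <= rho x &
    Num.min `|q x| 1 <= rho x].
Proof.
move=> xi0 HA e0; have e3 : 0 < e / 3 by rewrite divr_gt0.
have [Y [y [kap [rho [r [[aY ty tk trho re] Yyk]]]]]] := HA _ e3.
have [s s0 ys] := is_trig_bounded ty.
have s1 : 0 < 1 + s by rewrite addr_gt0.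
have dl0 : 0 < e / 3 / (1 + s) by rewrite divr_gt0.
have [H [h [H0 tH /andP[h0 hd] tH2 _]]] :=
  concentrating_kernel Aop_rank xi0 (mem0v _) dl0 ltr01.
near (pinfty_nbhs R) => N.
have [Z aZ ZP] : exists2 Z, is_afree Aop Z &
    forall x, `|Z x - H x ^+ 2 *: Y (N *: x)| <= e / 3.
  by near: N; exact: (is_afree_modulate Aop_rank tH2 aY).
exists Z, (fun x => H x ^+ 2 * y (N *: x)), (fun x => H x ^+ 2 * kap (N *: x)),
  (fun x => H x ^+ 2 * rho (N *: x) + e / 3 + (1 + s) * H x),
  (r + e / 3 + (1 + s) * h).
split; [split=> //|].
- by rewrite -(mulr0 1); near: N; exact: (is_trigM_dilate tH2 ty).
- have : is_trig (fun x => H x ^+ 2 * kap (N *: x)) (1 * 1).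
    by near: N; exact: (is_trigM_dilate tH2 tk).
  by rewrite mulr1.
- apply: (is_trigD (is_trigD _ (is_trig_cst d _)) (is_trigZ _ tH)).
  by rewrite -(mul1r r); near: N; exact: (is_trigM_dilate tH2 trho).
- by move: hd re; rewrite ler_pdivlMr// mulrC; lra.
move=> x; have [i1 i2] := Yyk (N *: x).
have H20 : 0 <= H x ^+ 2 by rewrite exprn_ge0.
have nH : 0 <= (1 + s) * H x by rewrite mulr_ge0// ltW.
have rho0 : 0 <= rho (N *: x) by apply: le_trans i1.
have Hrho : 0 <= H x ^+ 2 * rho (N *: x) by rewrite mulr_ge0.
split.
- rewrite -[leLHS]addr0 lerD ?nH//.
  have -> : Z x - (H x ^+ 2 * y (N *: x)) *: A =
      H x ^+ 2 *: (Y (N *: x) - y (N *: x) *: A) + (Z x - H x ^+ 2 *: Y (N *: x)).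
    by rewrite scalerBr scalerA [RHS]addrC addrA subrK.
  apply: le_trans (ler_normD _ _) (lerD _ (ZP x)).
  by rewrite normrZ ger0_norm// ler_wpM2l.
- rewrite normrM ger0_norm// -mulrBr normrM ger0_norm//.
  have : H x ^+ 2 * `| `|y (N *: x)| - kap (N *: x)| <= H x ^+ 2 * rho (N *: x).
    by rewrite ler_wpM2l.
  lra.
- rewrite -[leLHS]add0r lerD// ?addr_ge0 ?(ltW e3)//.
  rewrite normrM ger0_norm// [H x ^+ 2 * _]mulrC minC.
  have := double_min_sqr_le ler01 (normr_ge0 (y (N *: x))) (H0 x).
  have : (1 + `|y (N *: x)|) * H x <= (1 + s) * H x by rewrite ler_wpM2r// lerD2l.
  have : 0 <= Num.min 1 (`|y (N *: x)| * H x ^+ 2).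
    by rewrite le_min ler01 mulr_ge0.
  set t := Num.min _ _; lra.
Unshelve. all: by end_near. Qed.

End two_sided_concentration.

(** * Lebesgue measure and weak limits *)

Section borel_measurability.

Lemma open_borel_measurable (T : ptopologicalType) (A : set T) :
  open A -> measurable (A : set (borel T)).
Proof. by move=> oA; exact: sub_sigma_algebra. Qed.

Lemma closed_borel_measurable (T : ptopologicalType) (A : set T) :
  closed A -> measurable (A : set (borel T)).
Proof.
move=> cA; rewrite -[A]setCK; apply: measurableC.
by apply: open_borel_measurable; rewrite openC.
Qed.

Lemma within_open_borel_measurable (T : ptopologicalType) (D : set T)
    (U : set (subspace D)) :
  measurable (D : set (borel T)) -> open U ->
  measurable (D `&` U : set (borel T)).
Proof.
move=> mD /open_subspaceP[V oV VU]; rewrite setIC -VU setIC.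
by apply: measurableI => //; exact: open_borel_measurable.
Qed.

Lemma within_continuous_borel_measurable (T U : ptopologicalType) (D : set T)
    (f : T -> U) :
  measurable (D : set (borel T)) -> {within D, continuous f} ->
  measurable_fun (D : set (borel T)) (f : borel T -> borel U).
Proof.
move=> mD /continuousP cf.
apply: (@measurability _ _ (borel T) (borel U) D f (@open U)) => //.
by move=> _ [V oV <-]; apply: within_open_borel_measurable => //; exact: cf.
Qed.

Lemma within_continuous_measurable (R : realType) (T : ptopologicalType)
    (D : set T) (f : T -> R) :
  measurable (D : set (borel T)) -> {within D, continuous f} ->
  measurable_fun (D : set (borel T)) f.
Proof.
move=> mD /continuousP cf.
apply: (measurability _ (RGenOpens.measurableE R)).
move=> _ [_ [a [b ->] <-]]; apply: within_open_borel_measurable => //.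
exact/cf/interval_open.
Qed.

End borel_measurability.

(** * Translation invariance of Lebesgue measure *)

Section translation.
Variables (R : realType) (d : nat).
Local Notation T := (borel 'rV[R]_d).
Local Notation mu := (@lebesgue_rV R d).

Let boxes : set (set T) := [set B | exists a b : 'I_d -> R,
  B = [set x : 'rV[R]_d | forall i, `]a i, b i]%classic (x ord0 i)]].

Let box_measurable B : boxes B -> measurable (B : set T).
Proof.
move=> [a [b ->]].
rewrite (_ : [set _ | _] = \bigcap_(i in [set: 'I_d])
    ((fun x : T => x ord0 i) @^-1` `]a i, b i])); last first.
  apply/seteqP; split=> x xab i; first by move=> _; exact: xab.
  exact: (xab i Logic.I).
apply: fin_bigcap_measurable; first exact: finite_finset.
move=> i _; rewrite -[X in measurable X]setTI.
apply: (within_continuous_measurable (D := setT) (T := 'rV[R]_d)) => //.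
apply: continuous_subspaceT; exact: coord_continuous.
Qed.

Let boxes_setI : setI_closed boxes.
Proof.
move=> _ _ [a [b ->]] [a' [b' ->]].
exists (fun i => Num.max (a i) (a' i)), (fun i => Num.min (b i) (b' i)).
apply/seteqP; split => x.
  move=> [xa xb] i; have := xa i; have := xb i; rewrite /= !in_itv /=.
  by rewrite gt_max le_min => /andP[-> ->] /andP[-> ->].
by move=> xab; split=> i; have := xab i; rewrite /= !in_itv /=;
  rewrite gt_max le_min => /andP[/andP[h1 h2] /andP[h3 h4]]; apply/andP.
Qed.

Let boxes_generate : @measurable _ T = <<s boxes >>.
Proof.
apply/seteqP; split; last first.
  apply: smallest_sub; first exact: sigma_algebra_measurable.
  exact: box_measurable.
apply: smallest_sub; first exact: smallest_sigma_algebra.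
move=> U oU.
pose box (f : {ffun 'I_d -> rat * rat}) : set T :=
  [set x : 'rV[R]_d | forall i, `]ratr (f i).1, ratr (f i).2]%classic (x ord0 i)].
pose F f : set T := if `[< box f `<=` U >] then box f else set0.
have UF : U = \bigcup_f F f.
  apply/seteqP; split=> x; last first.
    by move=> [f _]; rewrite /F; case: asboolP => // fU; exact: fU.
  move=> Ux; have /nbhs_ballP[e /= e0 eU] : nbhs x U by exact: open_nbhs_nbhs.
  have /choice[f fP] (i : 'I_d) : exists pq : rat * rat,
      [/\ x ord0 i - e < ratr pq.1, ratr pq.1 < x ord0 i,
          x ord0 i < ratr pq.2 & ratr pq.2 < x ord0 i + e]%R.
    have /rat_in_itvoo[p] : (x ord0 i - e < x ord0 i)%R by rewrite gtrBl.
    have /rat_in_itvoo[q] : (x ord0 i < x ord0 i + e)%R by rewrite ltrDl.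
    rewrite !in_itv /= => /andP[q1 q2] /andP[p1 p2].
    by exists (p, q); split.
  exists [ffun i => f i] => //; rewrite /F; case: asboolP => [_ i|]; last first.
    case=> y yf; apply: eU; split=> // i j; rewrite ord1 /ball /=.
    have := yf j; rewrite /= in_itv /= ffunE => /andP[fx xf'].
    have [h1 _ _ h4] := fP j.
    by rewrite ltr_distlC (lt_trans h1 fx) (le_lt_trans xf' h4).
  by rewrite /= in_itv /= ffunE; have [_ -> /ltW ->] := fP i.
rewrite UF => S [sS bS].
pose S' := @measurable _ (g_sigma_algebraType boxes).
suff : S' (\bigcup_f F f) by apply; split.
apply: countable_bigcupT_measurable => // f; rewrite /F.
case: ifP => // _; apply: sub_sigma_algebra.
by exists (fun i => ratr (f i).1), (fun i => ratr (f i).2).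
Qed.

Lemma shift_continuous (h : 'rV[R]_d) : continuous (fun x : 'rV[R]_d => x + h).
Proof. move=> x; apply: (@cvgD _ _ _ (nbhs x) _ (fun x => x) (fun=> h)).
  exact: cvg_id.
exact: cvg_cst. Qed.

Lemma measurable_shift (h : 'rV[R]_d) :
  measurable_fun setT ((fun x => x + h) : T -> T).
Proof.
apply: within_continuous_borel_measurable => //.
exact/continuous_subspaceT/shift_continuous.
Qed.

Let lebesgue_rV_oc_box (a b : 'I_d -> R) :
  mu [set x : 'rV[R]_d | forall i, `]a i, b i]%classic (x ord0 i)] =
  (\prod_(i < d) lebesgue_measure (`]a i, b i]%classic : set R))%E.
Proof. exact: (lebesgue_rV_box (F := fun i => `]a i, b i]%classic)). Qed.

(** Measures agreeing on a generating family closed under intersections coincide. Half-open boxes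
    form such a family, the product formula gives their invariance, and the boxes [g k] exhaust the
    space with finite measure. *)
Lemma lebesgue_rV_shift (h : 'rV[R]_d) (A : set T) : measurable A ->
  mu ((fun x => x + h) @^-1` A) = mu A.
Proof.
move=> mA.
pose sh := mfun_Sub (mem_set (measurable_shift h)) : {mfun T >-> T}.
apply/esym.
pose g (k : nat) : set T := [set x : 'rV[R]_d | forall i, `](- k%:R), k%:R]%classic (x ord0 i)].
apply: (measure_unique boxes g boxes_generate boxes_setI _ _
  mu (pushforward mu sh)) => //.
- by move=> k; exists (fun=> - k%:R), (fun=> k%:R).
- apply/seteqP; split=> // x _.
  exists (Num.truncn `|x|).+1 => // i; rewrite /= in_itv /=.
  have : `|x ord0 i| < (Num.truncn `|x|).+1%:R.
    by apply: le_lt_trans (ler_entry_norm _ _ _) _; exact: truncnS_gt.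
  by rewrite ltr_norml => /andP[-> /ltW].
- move=> _ [a [b ->]]; rewrite /pushforward.
  apply: etrans; first exact: lebesgue_rV_oc_box.
  apply/esym.
  transitivity (mu [set x : 'rV[R]_d | forall i,
      `](a i - h ord0 i), (b i - h ord0 i)]%classic (x ord0 i)]).
    congr (mu _); apply/seteqP; split=> x xab i; have := xab i;
      by rewrite /= !in_itv /= mxE ltrBlDr lerBrDr.
  apply: etrans; first exact: lebesgue_rV_oc_box.
  apply: eq_bigr => i _.
  rewrite !lebesgue_measure_itv /= !lte_fin ltrD2r.
  case: ifP => // _; rewrite -!EFinB; congr EFin; ring.
- move=> k.
  change (lebesgue_rV (g k) < +oo)%E.
  rewrite (lebesgue_rV_oc_box (fun=> - k%:R) (fun=> k%:R)) -ge0_fin_numE; last exact: prode_ge0.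
  elim/big_ind : _ => // [x y|i _]; first exact: fin_numM.
  by rewrite lebesgue_measure_itv /=; case: ifP.
Qed.

Lemma bounded_lebesgue_rV_lty (A : set 'rV[R]_d) :
  measurable (A : set T) -> bounded_set A -> (mu A < +oo)%E.
Proof.
move=> mA [M [_ MP]]; pose B := 1 + `|M|.
pose box : set T := [set x : 'rV[R]_d | forall i, `](- (B + 1)), (B + 1)]%classic (x ord0 i)].
have bbox : boxes box by exists (fun=> - (B + 1)), (fun=> B + 1).
have Abox : A `<=` box.
  move=> x Ax i; rewrite /= in_itv /=.
  have : `|x ord0 i| < B + 1.
    rewrite (le_lt_trans (ler_entry_norm _ _ _))// (@le_lt_trans _ _ B)// ?ltrDl//.
    by apply: MP => //; rewrite /B ltr_pwDl// ler_norm.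
  by rewrite ltr_norml => /andP[-> /ltW].
apply: (@le_lt_trans _ _ (mu box)).
  by apply: (@le_measure _ _ _ mu) => //; rewrite inE//; exact: box_measurable.
have -> : mu box = _ := lebesgue_rV_oc_box (fun=> - (B + 1)) (fun=> B + 1).
rewrite -ge0_fin_numE; last exact: prode_ge0.
elim/big_ind : _ => // [x y|i _]; first exact: fin_numM.
by rewrite lebesgue_measure_itv /=; case: ifP.
Qed.

Lemma open_lebesgue_rV_gt0 (A : set 'rV[R]_d) : open A -> A !=set0 -> (0 < mu A)%E.
Proof.
move=> oA [x Ax].
have /nbhs_ballP[e /= e0 eA] : nbhs x A by exact: open_nbhs_nbhs.
pose box : set T := [set y : 'rV[R]_d | forall i,
  `](x ord0 i - e / 2), (x ord0 i + e / 2)]%classic (y ord0 i)].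
have bbox : boxes box.
  by exists (fun i => x ord0 i - e / 2), (fun i => x ord0 i + e / 2).
have boxA : box `<=` A.
  move=> y yb; apply: eA; split => // i j; rewrite ord1 /ball /=.
  have := yb j; rewrite /= in_itv /= => /andP[h1 h2].
  by rewrite ltr_distlC; apply/andP; split; lra.
apply: (@lt_le_trans _ _ (mu box)); last first.
  apply: (@le_measure _ _ _ mu) => //; rewrite inE.
    exact: box_measurable.
  exact: open_borel_measurable.
have -> : mu box = _ := lebesgue_rV_oc_box (fun i => x ord0 i - e / 2) (fun i => x ord0 i + e / 2).
elim/big_ind : _ => // [y z|i _]; first exact: mule_gt0.
rewrite lebesgue_measure_itv /= lte_fin ifT ?lte_fin; last by lra.
lra.
Qed.

End translation.

Section bounded_integrals.
Variables (R : realType) (dsp : measure_display) (T : measurableType dsp).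
Variables (mu : {measure set T -> \bar R}).
Implicit Types (D : set T) (f : T -> R).

Lemma bounded_integrable D f (C : R) : measurable D -> (mu D < +oo)%E ->
  measurable_fun D f -> (forall x, D x -> `|f x| <= C) ->
  mu.-integrable D (EFin \o f).
Proof.
move=> mD Doo mf fC; apply: measurable_bounded_integrable => //.
exists C; split; first exact: num_real.
by move=> y Cy x Dx; rewrite /= (le_trans (fC x Dx))// ltW.
Qed.

Lemma measure_ltyS (A B : set T) : measurable A -> measurable B -> A `<=` B ->
  (mu B < +oo)%E -> (mu A < +oo)%E.
Proof.
move=> mA mB AB; apply: le_lt_trans.
by apply: le_measure => //; rewrite inE.
Qed.

Lemma le_Rintegral_cst D f (C : R) : measurable D -> (mu D < +oo)%E ->
  measurable_fun D f -> (forall x, D x -> `|f x| <= C) ->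
  `|\int[mu]_(x in D) f x| <= C * fine (mu D).
Proof.
move=> mD Doo mf fC.
have fi := bounded_integrable mD Doo mf fC.
apply: le_trans (le_normr_Rintegral mD fi) _.
rewrite -Rintegral_cst//; apply: le_Rintegral => //.
- apply: (@bounded_integrable _ _ C) => //; last by move=> x Dx; rewrite normr_id fC.
  exact: measurableT_comp.
- apply: (@bounded_integrable _ _ `|C|) => //.
Qed.

End bounded_integrals.

(** * The Riemann-Lebesgue lemma, uniform in the test function *)

Section riemann_lebesgue.
Variables (R : realType) (d : nat) (Omega : set 'rV[R]_d).
Local Notation mu := (@lebesgue_rV R d).
Local Notation T := (borel 'rV[R]_d).
Hypotheses (oOmega : open Omega) (Omegaoo : (mu Omega < +oo)%E).

Let mOmega : measurable (Omega : set T).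
Proof. exact: open_borel_measurable. Qed.

Let shifted (h : 'rV[R]_d) : set T := (fun x => x + h) @^-1` Omega.

Let m_shifted h : measurable (shifted h).
Proof. by rewrite -[X in measurable X]setTI; exact: measurable_shift. Qed.

(** Each point of the open set [Omega] stays in it under small translations; finite measure allows
    dominated convergence. *)
Lemma lebesgue_rV_shift_diff (h : 'rV[R]_d) :
  mu (Omega `\` shifted (n.+1%:R^-1 *: h)) @[n --> \oo] --> 0%E.
Proof.
pose f n (x : T) : \bar R := (\1_(~` shifted (n.+1%:R^-1 *: h)) x)%:E.
have -> : (fun n => mu (Omega `\` shifted (n.+1%:R^-1 *: h))) =
    (fun n => \int[mu]_(x in Omega) f n x)%E.
  apply/funext => n; rewrite integral_indic//; last exact: measurableC.
  by rewrite setDE setIC.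
rewrite -(@integral0 _ _ _ mu Omega).
apply: (@dominated_cvg _ _ _ mu _ mOmega f (cst 0%E) (cst 1%E)) => //.
- move=> n; apply/measurable_EFinP; apply: measurable_indic.
  exact: measurableC.
- move=> x Ox.
  have cx : (x + n.+1%:R^-1 *: h : 'rV[R]_d) @[n --> \oo] --> x.
    rewrite -[X in _ --> X]addr0; apply: cvgD; first exact: cvg_cst.
    rewrite -(scale0r h); apply: cvgZr_tmp.
    exact: cvg_harmonic.
  have nO : nbhs x Omega by exact: open_nbhs_nbhs.
  apply: (cvg_near_cst); near=> n.
  rewrite /f indicE memNset// => /=; apply.
  by near: n; exact: (cx _ nO).
- apply/integrableP; split => //.
  under eq_integral do rewrite abse1.
  by rewrite integral_cst// mul1e.
- by move=> n x _; rewrite /f /= lee_fin ger0_norm// indicE; case: (_ \in _).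
Unshelve. all: by end_near. Qed.

Lemma Rintegral_shift (h : 'rV[R]_d) (f : T -> R) (C : R) :
  measurable_fun (Omega : set T) f -> (forall x, Omega x -> `|f x| <= C) ->
  \int[mu]_(x in Omega) f x = \int[mu]_(x in shifted h) f (x + h).
Proof.
move=> mf fC; rewrite /Rintegral; congr fine.
pose sh := mfun_Sub (mem_set (measurable_shift h)) : {mfun T >-> T}.
pose F : T -> \bar R := EFin \o (f \_ Omega).
have mF : measurable_fun setT F.
  by apply/measurable_EFinP; exact/(measurable_restrictT f mOmega).
transitivity (\int[mu]_(x in Omega) F x)%E.
  by apply: eq_integral => x xO; rewrite /F /= patchE xO.
transitivity (\int[pushforward mu sh]_(x in Omega) F x)%E.
  apply: eq_measure_integral => A mA _; rewrite /pushforward.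
  exact/esym/lebesgue_rV_shift.
rewrite integral_pushforward//.
  apply: eq_integral => x xO; rewrite /F /= patchE ifT//.
have mfs : measurable_fun (shifted h) (fun x => (f \_ Omega) (x + h)).
  apply: measurable_funTS.
  apply: (measurableT_comp _ (measurable_shift h)).
  exact/(measurable_restrictT f mOmega).
apply: (@bounded_integrable _ _ _ mu _ _ C) => //.
- exact: m_shifted.
- by move: Omegaoo; rewrite -(lebesgue_rV_shift h mOmega).
- by move=> x xO; rewrite patchE mem_set//; exact: fC.
Qed.

Let fine_shifted_diff h :
  fine (mu (shifted h `\` Omega)) = fine (mu (Omega `\` shifted h)).
Proof.
have ms := m_shifted h.
have shE : mu (shifted h) = mu Omega by exact: lebesgue_rV_shift.
have fin (A : set T) : measurable A -> A `<=` (Omega : set T) `|` shifted h -> mu A \is a fin_num.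
  move=> mA AO; rewrite ge0_fin_numE//.
  apply: le_lt_trans (le_measure mu _ _ AO) _; rewrite ?inE//.
    exact: measurableU.
  apply: le_lt_trans (measureU2 mu mOmega ms) _.
  apply: lte_add_pinfty => //.
  by move: Omegaoo; rewrite -(lebesgue_rV_shift h mOmega).
have := shE; rewrite (measureDI mu ms mOmega) (measureDI mu mOmega ms).
rewrite (setIC Omega) => /(congr1 fine); rewrite !fineD.
- by move/addIr.
- by apply: fin; [exact: measurableD|move=> x [? _]; left].
- by apply: fin; [exact: measurableI|move=> x [? _]; right].
- by apply: fin; [exact: measurableD|move=> x [? _]; right].
- by apply: fin; [exact: measurableI|move=> x [? _]; right].
Qed.

Let Rintegral_split D E (f : T -> R) (C : R) : measurable D -> measurable E ->
  (mu D < +oo)%E -> measurable_fun D f -> (forall x, D x -> `|f x| <= C) ->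
  \int[mu]_(x in D) f x =
  \int[mu]_(x in D `&` E) f x + \int[mu]_(x in D `\` E) f x.
Proof.
move=> mD mE Doo mf fC.
have DE : D = (D `&` E) `|` (D `\` E) by rewrite setUIDK.
rewrite {1}DE Rintegral_setU//.
- exact: measurableI.
- exact: measurableD.
- by rewrite -DE; exact: (bounded_integrable mD Doo mf fC).
- by apply/disj_setPS => x [[_ Ex] [_]].
Qed.

(** Translation by half a period flips the sign of the cosine, so twice the integral is that of an
    increment of [phi] plus two boundary layers. All bounds depend on [phi] through [B] alone, so
    one [n] serves every [phi]. *)
Lemma riemann_lebesgue z (B e : R) : z != 0 -> 0 < B -> 0 < e ->
  \forall n \near \oo, forall phi : T -> R,
    measurable_fun (Omega : set T) phi -> (forall x, Omega x -> `|phi x| <= B) ->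
    (forall x y, Omega x -> Omega y -> `|phi x - phi y| <= B * `|x - y|) ->
    `|\int[mu]_(x in Omega) (phi x * cos (dot z (n.+1%:R *: x)))| <= e.
Proof.
move=> z0 B0 e0.
have zz0 : 0 < dot z z.
  have /rV0Pn[i zi] := z0; rewrite /dot (bigD1 i)//= ltr_pwDl//.
    by rewrite -expr2 lt0r sqr_ge0 expf_neq0.
  by rewrite sumr_ge0// => j _; rewrite -expr2 sqr_ge0.
(* The half period along [z]: moving [x] by [h0 / (n + 1)] adds [pi] to the phase. *)
pose h0 := (pi / dot z z) *: z.
have zh0 : dot z h0 = pi by rewrite dotZr divfK// gt_eqF.
pose m := fine (mu Omega).
have m0 : 0 <= m by rewrite fine_ge0.
have cd : fine (mu (Omega `\` shifted (n.+1%:R^-1 *: h0))) @[n --> \oo] --> 0.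
  by apply: fine_cvg; exact: lebesgue_rV_shift_diff.
have ch : n.+1%:R^-1 * (`|h0| * m) @[n --> \oo] --> 0.
  rewrite -(mul0r (`|h0| * m)); apply: cvgMr_tmp; exact: cvg_harmonic.
have e1 : 0 < e / (2 * B) by rewrite divr_gt0// mulr_gt0.
pose sh (n : nat) := n.+1%:R^-1 *: h0.
near=> n.
have dB : fine (mu (Omega `\` shifted (sh n))) <= e / (2 * B).
  rewrite -[leLHS]ger0_norm ?fine_ge0// -[X in `|X|]subr0 distrC.
  by near: n; move/cvgrPdist_le : cd; exact.
have hB : `|sh n| * m <= e / (2 * B).
  rewrite normrZ normfV ger0_norm// -mulrA -[leLHS]ger0_norm ?mulr_ge0// -[X in `|X|]subr0 distrC.
  by near: n; move/cvgrPdist_le : ch; exact.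
move: dB hB; set h := sh n => dB hB.
move=> phi mphi phiB phiL.
pose c (x : T) : R := cos (dot z (n.+1%:R *: x)).
have cb x : `|c x| <= 1 by rewrite ler_norml cos_geN1 cos_le1.
have mc : measurable_fun setT c.
  apply: (within_continuous_measurable (T := 'rV[R]_d)) => //.
  apply: continuous_subspaceT.
  rewrite (_ : c = fun x => 1 * cos (dot (n.+1%:R *: z) x)).
    exact: is_trig_continuous (is_trig_cos _ _).
  by apply/funext => x; rewrite mul1r dotZl -dotZr.
have ch' x : c (x + h) = - c x.
  rewrite /c scalerDr scalerA mulfV ?scale1r ?pnatr_eq0// dotDr zh0.
  by rewrite cosDpi.
have ms := m_shifted h.
have shoo : (mu (shifted h) < +oo)%E by rewrite lebesgue_rV_shift.
pose f x := phi x * c x.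
have fB x : Omega x -> `|f x| <= B.
  by move=> Ox; rewrite normrM -[B]mulr1 ler_pM// phiB.
have mf : measurable_fun (Omega : set T) f.
  by apply: measurable_funM => //; exact: measurable_funTS.
pose g x := phi (x + h) * c x.
have gB x : shifted h x -> `|g x| <= B.
  by move=> Ox; rewrite normrM -[B]mulr1 ler_pM// phiB.
have mg : measurable_fun (shifted h) g.
  apply: measurable_funM; last exact: measurable_funTS.
  apply: (@measurable_comp _ _ _ _ _ _ (Omega : set T) phi) => //.
    by move=> _ [x ? <-].
  exact: measurable_funTS (measurable_shift h).
have fg : \int[mu]_(x in Omega) f x = - \int[mu]_(x in shifted h) g x.
  rewrite (Rintegral_shift h mf fB) -mulN1r -RintegralZl//; last first.
    exact: (bounded_integrable ms shoo mg gB).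
  by apply: eq_Rintegral => x _; rewrite /f /g ch' mulrN mulN1r.
have f1 := Rintegral_split mOmega ms Omegaoo mf fB.
have g1 := Rintegral_split ms mOmega shoo mg gB.
pose I : set T := (Omega : set T) `&` shifted h.
have mI : measurable I by exact: measurableI.
have Ioo : (mu I < +oo)%E.
  by apply: (measure_ltyS mI mOmega) => // x [].
have d1 : `|\int[mu]_(x in (Omega : set T) `\` shifted h) f x| <= B * fine (mu (Omega `\` shifted h)).
  apply: le_Rintegral_cst.
  - exact: measurableD.
  - by apply: (measure_ltyS _ mOmega) => //; exact: measurableD.
  - by apply: measurable_funS mf => //.
  - by move=> x [Ox _]; exact: fB.
have d2 : `|\int[mu]_(x in shifted h `\` (Omega : set T)) g x| <= B * fine (mu (Omega `\` shifted h)).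
  rewrite -fine_shifted_diff; apply: le_Rintegral_cst.
  - exact: measurableD.
  - by apply: (measure_ltyS _ ms) => //; exact: measurableD.
  - by apply: measurable_funS mg => //.
  - by move=> x [Ox _]; exact: gB.
have mfI : measurable_fun I f by apply: measurable_funS mf => // x [].
have mgI : measurable_fun I g by apply: measurable_funS mg => // x [].
have d3 : `|\int[mu]_(x in I) f x - \int[mu]_(x in I) g x| <= B * `|h| * m.
  rewrite -RintegralB//; last 2 first.
  - by apply: (bounded_integrable mI Ioo mfI (C := B)) => x [? _]; exact: fB.
  - by apply: (bounded_integrable mI Ioo mgI (C := B)) => x [_ ?]; exact: gB.
  apply: le_trans (le_Rintegral_cst (C := B * `|h|) mI Ioo _ _) _.
  - exact: measurable_funB.
  - move=> x [Ox Ox']; rewrite /f /g -mulrBl normrM -[leRHS]mulr1 ler_pM//.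
    by apply: le_trans (phiL _ _ Ox Ox') _; rewrite opprD addrA subrr sub0r normrN.
  - rewrite ler_wpM2l// ?mulr_ge0 ?(ltW B0)// fine_le// ?ge0_fin_numE//.
    by apply: (@le_measure _ _ _ mu); rewrite ?inE// => x [].
have Bd : B * fine (mu (Omega `\` shifted h)) <= e / 2.
  by rewrite mulrC -ler_pdivlMr// -mulrA -invfM.
have Bh : B * `|h| * m <= e / 2.
  by rewrite -mulrA mulrC -ler_pdivlMr// -mulrA -invfM.
change (`|\int[mu]_(x in Omega) f x| <= e).
move: f1 g1; rewrite (setIC (shifted h)) -/I => f1 g1.
move: d1 d2 d3 Bd Bh fg f1 g1 e0.
set F := \int[mu]_(x in Omega) f x.
set G := \int[mu]_(x in shifted h) g x.
set I1 := \int[mu]_(x in I) f x; set I2 := \int[mu]_(x in I) g x.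
set a := \int[mu]_(x in _) f x; set b := \int[mu]_(x in _) g x.
(* From [F = - G] follows [2 F = (I1 - I2) + a - b], of modulus at most [3 e / 2]. *)
rewrite !ler_norml => /andP[? ?] /andP[? ?] /andP[? ?] *; apply/andP; split; lra.
Unshelve. all: by end_near. Qed.

Lemma measurable_trig u k (t : R) : is_trig u k ->
  measurable_fun setT (fun x : T => u (t *: x)).
Proof.
move=> tu; apply: (within_continuous_measurable (T := 'rV[R]_d)) => //.
apply: continuous_subspaceT => x.
apply: continuous_comp; first exact: scaler_continuous.
exact: (is_trig_continuous tu).
Qed.

Lemma integrableM_trig u k (t B : R) (phi : T -> R) : is_trig u k ->
  measurable_fun (Omega : set T) phi -> (forall x, Omega x -> `|phi x| <= B) ->
  mu.-integrable Omega (EFin \o (fun x => phi x * u (t *: x))).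
Proof.
move=> tu mphi phiB; have [C C0 uC] := is_trig_bounded tu.
apply: (@bounded_integrable _ _ _ mu _ _ (B * C)) => //.
  apply: measurable_funM => //.
  by apply: measurable_funTS; exact: (measurable_trig t tu).
by move=> x Ox; rewrite normrM ler_pM// phiB.
Qed.

(** Nonzero frequencies disappear by [riemann_lebesgue] and the constant coefficient survives: here
    the formal mean becomes an actual average. *)
Lemma trig_weak_limit u k (B e : R) : is_trig u k -> 0 < B -> 0 < e ->
  \forall n \near \oo, forall phi : T -> R,
    measurable_fun (Omega : set T) phi -> (forall x, Omega x -> `|phi x| <= B) ->
    (forall x y, Omega x -> Omega y -> `|phi x - phi y| <= B * `|x - y|) ->
    `|\int[mu]_(x in Omega) (phi x * u (n.+1%:R *: x)) -
      k * \int[mu]_(x in Omega) phi x| <= e.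
Proof.
(* The predicate retains [is_trig], because splitting the integral of a sum requires integrability
   of both terms. *)
move=> tu B0; move: e; pose Q u k := is_trig u k /\ forall e, 0 < e ->
  \forall n \near \oo, forall phi : T -> R,
    measurable_fun (Omega : set T) phi -> (forall x, Omega x -> `|phi x| <= B) ->
    (forall x y, Omega x -> Omega y -> `|phi x - phi y| <= B * `|x - y|) ->
    `|\int[mu]_(x in Omega) (phi x * u (n.+1%:R *: x)) -
      k * \int[mu]_(x in Omega) phi x| <= e.
suff : Q u k by case.
apply: (is_trig_ind tu) => {u k tu}.
- by move=> u w k /funext ->.
- split=> [|e e0]; first exact: is_trig_cst.
  near=> n => phi _ _ _.
  under eq_Rintegral do rewrite mulr0.
  by rewrite mul0r subr0 Rintegral_cst// mul0r normr0 ltW.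
- move=> a z; split=> [|e e0]; first exact: is_trig_cos.
  have [->|z0] := eqVneq z 0.
    near=> n => phi mphi phiB _.
    have := bounded_integrable mOmega Omegaoo mphi phiB => iphi.
    under eq_Rintegral do rewrite dot0l cos0 mulr1 mulrC.
    by rewrite RintegralZl// subrr normr0 ltW.
  have a0 : 0 < 1 + `|a| by rewrite ltr_pwDl.
  have ea : 0 < e / (1 + `|a|) by rewrite divr_gt0.
  have := riemann_lebesgue z0 B0 ea; apply: filterS => n H phi mphi phiB phiL.
  rewrite mul0r subr0.
  under eq_Rintegral do rewrite mulrCA.
  rewrite RintegralZl//; last first.
    apply: eq_integrable (integrableM_trig n.+1%:R (is_trig_cos 1 z) mphi phiB) => //.
    by move=> x _ /=; rewrite mul1r.
  rewrite normrM; apply: (@le_trans _ _ (`|a| * (e / (1 + `|a|)))).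
    by rewrite ler_wpM2l// H.
  by rewrite mulrCA ler_piMr// ?(ltW e0)// ler_pdivrMr// mul1r lerDr.
- move=> u w j k [tu Hu] [tw Hw]; split=> [|e e0]; first exact: is_trigD.
  have e2 : 0 < e / 2 by rewrite divr_gt0.
  move: (Hu _ e2) (Hw _ e2); apply: filterS2 => n Hn Hn' phi mphi phiB phiL.
  have iu := integrableM_trig n.+1%:R tu mphi phiB.
  have iw := integrableM_trig n.+1%:R tw mphi phiB.
  have := Hn phi mphi phiB phiL; have := Hn' phi mphi phiB phiL.
  have -> : \int[mu]_(x in Omega) (phi x * (u \+ w) (n.+1%:R *: x)) =
    \int[mu]_(x in Omega) (phi x * u (n.+1%:R *: x)) +
    \int[mu]_(x in Omega) (phi x * w (n.+1%:R *: x)).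
    by rewrite -RintegralD//; apply: eq_Rintegral => x _ /=; rewrite mulrDr.
  move=> hw hu; rewrite mulrDl opprD addrACA (le_trans (ler_normD _ _))//.
  by rewrite [leRHS](splitr e) lerD.
Unshelve. all: by end_near. Qed.

End riemann_lebesgue.

(** * Smoothness and the differential operator *)

Section plane_waves.
Variables (R : realType) (d k : nat) (W X : finInnerType R).
Variable Aop : multi_index d k -> 'Hom(W, X).
Local Notation rV := 'rV[R]_d.
Implicit Types (l : seq (W * rV * R)) (x : rV).

(** The extra phase keeps the class stable under derivatives without sines: differentiating adds
    [pi / 2] to the phase and multiplies the amplitude by a component of the frequency. *)
Definition wave (p : W * rV * R) x : W := cos (dot p.1.2 x + p.2) *: p.1.1.

Definition waves l x : W := \sum_(p <- l) wave p x.

Definition dwave i (p : W * rV * R) : W * rV * R :=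
  (p.1.2 ord0 i *: p.1.1, p.1.2, p.2 + pi / 2).

Lemma dot_delta (z : rV) i : dot z 'e_i = z ord0 i.
Proof.
rewrite /dot (bigD1 i)//= big1 ?addr0.
  by rewrite mxE !eqxx mulr1.
by move=> j ji; rewrite mxE (negbTE ji) andbF mulr0.
Qed.

Let cos_affine_derive (a c : R) :
  is_derive (0 : R) 1 (fun h => cos (h * a + c)) (a * cos (c + pi / 2)).
Proof.
have h1 : is_derive (0 : R) 1 (fun h : R => h * a + c) (a + 0).
  apply: is_deriveD.
  suff {2}-> : a = 0 *: 0 + (cst a (0 : R))%:A.
    exact: is_deriveM (is_derive_id (0 : R) 1) (is_derive_cst a (0 : R) 1).
  by rewrite scaler0 add0r /GRing.scale /= mulr1.
have D := @is_derive1_comp R cos (fun h => h * a + c) 0 _ _ (is_derive_cos (0 * a + c)) h1.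
suff -> : a * cos (c + pi / 2) = - sin (0 * a + c) * (a + 0) by exact: D.
by rewrite mul0r add0r addr0 cosDpihalf mulrC.
Qed.

Lemma wave_is_derive p x i : is_derive x 'e_i (wave p) (wave (dwave i p) x).
Proof.
have [dg gE] := cos_affine_derive (p.1.2 ord0 i) (dot p.1.2 x + p.2).
have cv : h^-1 *: ((wave p \o shift x) (h *: 'e_i) - wave p x) @[h --> 0^'] -->
    wave (dwave i p) x.
  rewrite /wave /= scalerA mulrC addrA -gE.
  rewrite (_ : (fun h => _) = (fun h => (h^-1 *: (((fun h => cos (h * p.1.2 ord0 i + (dot p.1.2 x + p.2))) \o shift 0) (h *: 1) -
    cos (0 * p.1.2 ord0 i + (dot p.1.2 x + p.2)))) *: p.1.1)).
    exact: cvgZr_tmp.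
  apply/funext => h /=; rewrite -scalerBl scalerA; congr (_ *: _).
  rewrite addr0 mul0r add0r /GRing.scale /= mulr1; congr (_ * (cos _ - _)).
  by rewrite dotDr dotZr dot_delta addrA.
split; first exact: cvgP cv.
exact: cvg_lim cv.
Qed.

Lemma waves_is_derive l x i :
  is_derive x 'e_i (waves l) (waves (map (dwave i) l) x).
Proof.
elim: l => [|p l IH].
  rewrite (_ : waves [::] = cst 0).
    exact: is_derive_cst.
  by apply/funext => y; rewrite /waves big_nil.
rewrite (_ : waves (p :: l) = wave p + waves l).
  rewrite [X in is_derive _ _ _ X](_ : _ = wave (dwave i p) x + waves (map (dwave i) l) x).
    apply: is_deriveD; exact: wave_is_derive.
  by rewrite /waves /= big_cons.
by apply/funext => y; rewrite /waves big_cons.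
Qed.

Lemma partial_waves l i : partial i (waves l) = waves (map (dwave i) l).
Proof.
by apply/funext => x; rewrite /partial; have [_ ->] := waves_is_derive l x i.
Qed.

Lemma waves_continuous l : continuous (waves l).
Proof.
apply: continuous_big => [|p _ x]; first exact: add_continuous.
apply: (@cvgZr_tmp _ _ _ (nbhs x) _ (fun x => cos (dot p.1.2 x + p.2))).
apply: (continuous_comp (f := fun x => dot p.1.2 x + p.2)); last exact: continuous_cos.
apply: (@cvgD _ _ _ (nbhs x) _ (dot p.1.2)); last exact: cvg_cst.
exact: dot_continuous.
Qed.

Lemma smooth_on_waves (Omega : set rV) l : smooth_on Omega (waves l).
Proof.
move=> s x _.
have [m ->] : exists m, partials s (waves l) = waves m.
  elim: s => [|i s [m IH]]; first by exists l.
  by exists (map (dwave i) m); rewrite /= IH partial_waves.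
split; first exact: waves_continuous.
by move=> i; have [] := waves_is_derive m x i.
Qed.

Lemma iter_partial_waves l i n : iter n (partial i) (waves l) =
  waves [seq (p.1.2 ord0 i ^+ n *: p.1.1, p.1.2, p.2 + n%:R * (pi / 2)) | p : W * rV * R <- l].
Proof.
elim: n => [|n IH].
  rewrite /= -[in LHS](map_id l); congr waves; apply: eq_map => -[[v z] t] /=.
  by rewrite expr0 scale1r mul0r addr0.
rewrite iterS IH partial_waves -map_comp; congr waves.
apply: eq_map => -[[v z] t] /=; rewrite /dwave /= scalerA -exprS.
move: (pi / 2) => c; congr (_, _, _).
by rewrite -[n.+1%:R]natr1 mulrDl mul1r addrA.
Qed.

Lemma mpartial_waves (alpha : multi_index d k) l : mpartial alpha (waves l) =
  waves [seq ((\prod_i p.1.2 ord0 i ^+ val alpha i) *: p.1.1, p.1.2,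
              p.2 + k%:R * (pi / 2)) | p : W * rV * R <- l].
Proof.
have main (s : seq 'I_d) :
    foldr (fun i => iter (val alpha i) (partial i)) (waves l) s =
    waves [seq ((\prod_(i <- s) p.1.2 ord0 i ^+ val alpha i) *: p.1.1, p.1.2,
      p.2 + (\sum_(i <- s) val alpha i)%N%:R * (pi / 2)) | p : W * rV * R <- l].
  elim: s => [|i s IH] /=.
    rewrite -[in LHS](map_id l); congr waves; apply: eq_map => -[[v z] t] /=.
    by rewrite !big_nil scale1r mul0r addr0.
  rewrite IH iter_partial_waves -map_comp; congr waves.
  move: (pi / 2) => c.
  apply: eq_map => -[[v z] t] /=; rewrite !big_cons scalerA natrD mulrDl.
  by rewrite -addrA [X in t + X]addrC.
rewrite /mpartial main; congr waves; apply: eq_map => p.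
by rewrite !big_enum /= (eqP (valP alpha)).
Qed.

(** All multi-indices of length [k] shift the phase by the same [k pi / 2], so the cosine factors
    out and the symbol acts on the amplitude. *)
Lemma diffop_waves l x :
  (forall p, p \in l -> p.1.1 \in lker (symbol Aop p.1.2)) ->
  diffop Aop (waves l) x = 0.
Proof.
move=> lP; rewrite /diffop.
under eq_bigr => alpha _.
  rewrite mpartial_waves /waves big_map linear_sum /=.
  under eq_bigr => p _ do rewrite /wave /= !linearZ /=.
  over.
rewrite exchange_big /= big_seq big1// => p /lP.
rewrite memv_ker symbolE => /eqP pk.
by rewrite -scaler_sumr pk scaler0.
Qed.

Lemma is_afree_waves (Z : rV -> W) (t : R) : is_afree Aop Z ->
  exists2 l, (fun x => Z (t *: x)) = waves l &
    forall p, p \in l -> p.1.1 \in lker (symbol Aop p.1.2).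
Proof.
move=> [l lP Zl]; exists [seq (p.1, t *: p.2, 0) | p : W * rV <- l].
  apply/funext => x; rewrite Zl /waves big_map; apply: eq_bigr => p _.
  by rewrite /wave /= addr0 dotZl dotZr.
move=> _ /mapP[p /lP[_]] + -> /=.
by rewrite !memv_ker symbolZ => /eqP ->; rewrite scaler0.
Qed.

(* The symbol vanishes at 0 unless k = 0, in which case it is constant. *)
Lemma linear_span_lker_symbol0 (A : W) : linear_span (wave_cone Aop) A ->
  A \in lker (symbol Aop 0).
Proof.
move=> [n [c [v [vP ->]]]]; apply: memv_suml => i _; apply: memvZ.
have [xi _] := vP i; rewrite !memv_ker -(scale0r xi) symbolZ => /eqP ->.
by rewrite scaler0.
Qed.

Lemma afree_field_smooth (A : W) (Z : rV -> W) (t : R) (Omega : set rV) :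
  linear_span (wave_cone Aop) A -> is_afree Aop Z ->
  smooth_on Omega (fun x => A + Z (t *: x)) /\
  forall x, diffop Aop (fun x => A + Z (t *: x)) x = 0.
Proof.
move=> spA /(is_afree_waves t)[l Zl lP].
(* The constant [A] is a wave of frequency and phase 0. *)
have -> : (fun x => A + Z (t *: x)) = waves ((A, 0, 0) :: l).
  apply/funext => x; rewrite /waves big_cons /wave /= dot0l addr0 cos0 scale1r.
  by congr (_ + _); exact: (congr1 (fun f => f x) Zl).
split; first exact: smooth_on_waves.
move=> x; apply: diffop_waves => p; rewrite inE => /orP[/eqP ->|]; last exact: lP.
exact: linear_span_lker_symbol0.
Qed.

End plane_waves.

(** * Integrands and recession functions *)

Section compact_uniform_continuity.
Variables (R : realType) (V : normedModType R) (K : set V) (g : V -> R).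
Hypotheses (cK : compact K) (cg : {within K, continuous g}).

Lemma within_continuous_compact_bounded :
  exists2 M : R, 0 < M & forall p, K p -> `|g p| <= M.
Proof.
have [M [_ MP]] := compact_bounded (continuous_compact cg cK).
exists (1 + `|M|); first by rewrite ltr_pwDl.
by move=> p Kp; apply: MP; [rewrite ltr_pwDl// ler_norm|exists p].
Qed.

(** Uniform continuity handles nearby points; for distant ones [2 M] is absorbed by [C |p - q|].
    This affine modulus is the input of [lipschitz_approximation]. *)
Lemma within_continuous_compact_modulus (e : R) : 0 < e ->
  exists2 C : R, 0 < C &
    forall p q, K p -> K q -> `|g p - g q| <= e + C * `|p - q|.
Proof.
move=> e0; have [M M0 gM] := within_continuous_compact_bounded.
have e2 : 0 < e / 2 by rewrite divr_gt0.
have /compact_near_coveringP/(_ _ (0^'+ : set_system R)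
    (fun r p => K p -> forall q, K q -> `|p - q| < r -> `|g p - g q| <= e)) := cK.
case.
  move=> x Kx; move/subspace_continuousP : cg => /(_ x Kx) /cvgrPdist_le /(_ _ e2).
  rewrite near_withinE => /nbhs_ballP[r /= r0 rP].
  have r2 : 0 < r / 2 by rewrite divr_gt0.
  exists (ball x (r / 2), [set s : R | s < r / 2]).
    split; first exact: nbhsx_ballx.
    exact: nbhs_right_lt.
  move=> [p s] /= [xp sr] Kp q Kq pq.
  have xp' : ball x r p by apply: le_ball xp; lra.
  have xq : ball x r q.
    rewrite (splitr r); apply: ball_triangle xp _.
    by rewrite -ball_normE /ball_ /= (lt_trans pq).
  have := rP _ xp' Kp; have := rP _ xq Kq.
  have := ler_distD (g x) (g p) (g q).
  rewrite (distrC (g p) (g x)); lra.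
move=> r /= r0 rP.
have r2 : 0 < r / 2 by rewrite divr_gt0.
have {}rP p q : K p -> K q -> `|p - q| < r / 2 -> `|g p - g q| <= e.
  move=> Kp Kq; apply: (rP (r / 2)) => //=.
  by rewrite sub0r normrN gtr0_norm// ltr_pdivrMr// ltr_pMr// ltr1n.
exists (2 * M / (r / 2)); first by rewrite divr_gt0// mulr_gt0.
move=> p q Kp Kq; have [pq|pq] := ltP (`|p - q|) (r / 2).
  have : 0 <= 2 * M / (r / 2) * `|p - q|.
    by rewrite mulr_ge0// ltW// divr_gt0// mulr_gt0.
  by have := rP _ _ Kp Kq pq; lra.
apply: (@le_trans _ _ (2 * M)).
  by have := ler_normB (g p) (g q); have := gM _ Kp; have := gM _ Kq; lra.
rewrite -[leLHS]add0r lerD ?(ltW e0)//.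
by rewrite -mulrA ler_peMr ?mulr_ge0 ?(ltW M0)// ler_pdivlMl// mulr1.
Qed.

End compact_uniform_continuity.

(** * Lipschitz approximation *)

Section lipschitz_approximation.
Variables (R : realType) (V : normedModType R) (D : set V) (phi : V -> R).
Variables (M e C : R).
Hypothesis C0 : 0 <= C.
Hypothesis phiM : forall x, D x -> `|phi x| <= M.
Hypothesis phiC : forall x y, D x -> D y -> `|phi x - phi y| <= e + C * `|x - y|.

(** The infimal convolution of [phi] with [C |x - y|]: an infimum of [C]-Lipschitz functions, never
    above [phi], and by the affine modulus never more than [e] below it. *)
Lemma lipschitz_approximation : exists psi : V -> R,
  [/\ forall x, D x -> `|psi x| <= M,
      forall x y, D x -> D y -> `|psi x - psi y| <= C * `|x - y| &
      forall x, D x -> `|phi x - psi x| <= e].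
Proof.
pose S x := [set phi y + C * `|x - y| | y in D].
pose psi x := inf (S x).
have lbS x : lbound (S x) (- M).
  move=> _ [y Dy <-]; have := phiM Dy; rewrite ler_norml => /andP[h _].
  by rewrite (le_trans h)// lerDl mulr_ge0.
have hS x : D x -> has_inf (S x).
  move=> Dx; split; last by exists (- M); exact: lbS.
  by exists (phi x + C * `|x - x|); exists x.
have psi_le x : D x -> psi x <= phi x.
  move=> Dx; apply: ge_inf; first by have [] := hS x Dx.
  by exists x => //; rewrite subrr normr0 mulr0 addr0.
have psi_ge x : D x -> phi x - e <= psi x.
  move=> Dx; apply: lb_le_inf; first by have [] := hS x Dx.
  move=> _ [y Dy <-]; have := phiC Dx Dy; rewrite ler_norml => /andP[_]; lra.
have psiL x y : D x -> D y -> psi x - C * `|x - y| <= psi y.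
  move=> Dx Dy; apply: lb_le_inf; first by have [] := hS y Dy.
  move=> _ [z Dz <-].
  have : psi x <= phi z + C * `|x - z|.
    by apply: ge_inf; [have [] := hS x Dx|exists z].
  have : C * `|x - z| <= C * (`|x - y| + `|y - z|).
    by rewrite ler_wpM2l// ler_distD.
  lra.
exists psi; split.
- move=> x Dx; rewrite ler_norml; apply/andP; split.
    by apply: lb_le_inf; [have [] := hS x Dx|exact: lbS].
  by rewrite (le_trans (psi_le x Dx))// (le_trans (ler_norm _))// phiM.
- move=> x y Dx Dy; rewrite ler_norml; apply/andP; split.
    by have := psiL y x Dy Dx; rewrite distrC; lra.
  by have := psiL x y Dx Dy; lra.
- move=> x Dx; rewrite ler_norml; apply/andP; split.
    have := psi_le x Dx; have := phiC Dx Dx; rewrite (subrr x) normr0 mulr0 addr0 subrr normr0; lra.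
  by have := psi_ge x Dx; lra.
Qed.

End lipschitz_approximation.

Lemma lipschitz_within_continuous (R : realType) (V : normedModType R) (D : set V)
    (phi : V -> R) (C : R) :
  (forall x y, D x -> D y -> `|phi x - phi y| <= C * `|x - y|) ->
  {within D, continuous phi}.
Proof.
move=> phiC; apply/subspace_continuousP => x Dx.
apply/cvgrPdist_le => e e0; rewrite near_withinE.
have C1 : 0 < 1 + `|C| by rewrite ltr_pwDl.
near=> y => Dy; apply: le_trans (phiC x y Dx Dy) _.
apply: (@le_trans _ _ ((1 + `|C|) * `|x - y|)).
  by rewrite ler_wpM2r// (le_trans (ler_norm C))// lerDr.
rewrite -ler_pdivlMl// mulrC; near: y.
apply: (@cvgr_dist_le _ _ _ (nbhs x) _ id x) => //; last by rewrite divr_gt0.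
Unshelve. all: by end_near. Qed.

(** * Functions of linear growth in the ball chart *)

Section radial_extension.
Variables (R : realType) (W : normedModType R) (G : W -> R) (M e C : R).
Hypotheses (M0 : 0 <= M) (e0 : 0 <= e) (C0 : 0 <= C).
Hypothesis GM : forall w, `|w| <= 1 -> `|G w| <= M.
Hypothesis GC : forall a b, `|a| <= 1 -> `|b| <= 1 ->
  `|G a - G b| <= e + C * `|a - b|.

(* The function whose sphere transform is G. *)
Definition radial (z : W) : R := (1 + `|z|) * G ((1 + `|z|)^-1 *: z).

Let n1 (z : W) : 0 < 1 + `|z|. Proof. by rewrite ltr_pwDl. Qed.

Let norm_chart (z : W) : `|(1 + `|z|)^-1 *: z| <= 1.
Proof.
rewrite normrZ normfV ger0_norm ?(ltW (n1 z))// mulrC ler_pdivrMr ?n1// mul1r.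
by rewrite lerDr.
Qed.

Lemma norm_radial z : `|radial z| <= (1 + `|z|) * M.
Proof. by rewrite normrM ger0_norm ?(ltW (n1 z))// ler_wpM2l ?(ltW (n1 z))// GM. Qed.

(** The chart [z / (1 + |z|)] shrinks distances by a factor of order [1 / (1 + |z'|)], which offsets
    the linear growth of the prefactor; only the error [e] is amplified. *)
Lemma radial_dist z z' :
  `|radial z - radial z'| <= (M + 2 * C) * `|z - z'| + e * (1 + `|z'|).
Proof.
set a := (1 + `|z|)^-1 *: z; set b := (1 + `|z'|)^-1 *: z'.
have ab : (1 + `|z'|) * `|a - b| <= 2 * `|z - z'|.
  have -> : a - b = (1 + `|z'|)^-1 *: ((z - z') + (`|z'| - `|z|) *: a).
    rewrite scalerDr scalerA /a scalerA -mulrA.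
    have -> : (1 + `|z'|)^-1 * ((`|z'| - `|z|) * (1 + `|z|)^-1) =
       (1 + `|z|)^-1 - (1 + `|z'|)^-1.
      by field; rewrite !gt_eqF ?n1.
    by rewrite scalerBl scalerBr [RHS]addrC addrA subrK.
  rewrite normrZ normfV ger0_norm ?(ltW (n1 _))// mulVKf ?gt_eqF ?n1//.
  rewrite (le_trans (ler_normD _ _))// mulr_natl mulr2n lerD// normrZ.
  rewrite -[leRHS]mulr1 ler_pM ?norm_chart//.
  by rewrite distrC ler_dist_dist.
have -> : radial z - radial z' =
    (`|z| - `|z'|) * G a + (1 + `|z'|) * (G a - G b).
  by rewrite /radial -/a -/b; ring.
apply: le_trans (ler_normD _ _) _; rewrite !normrM [`|1 + _|]ger0_norm ?(ltW (n1 _))//.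
have h1 : `| `|z| - `|z'| | * `|G a| <= `|z - z'| * M.
  by rewrite ler_pM ?ler_dist_dist// GM// norm_chart.
have h2 : (1 + `|z'|) * `|G a - G b| <= (1 + `|z'|) * (e + C * `|a - b|).
  by rewrite ler_wpM2l ?(ltW (n1 _))// GC// norm_chart.
have h3 : C * ((1 + `|z'|) * `|a - b|) <= C * (2 * `|z - z'|) by rewrite ler_wpM2l.
move: h1 h2 h3; set s := `|z - z'|; set u := `|a - b|; set t := 1 + `|z'|; lra.
Qed.

(** The chart sends [t u] to a point at distance [1 / (1 + t)] from [u], so the factor [t] costs
    only a constant. *)
Lemma radial_recession u t : `|u| = 1 -> 0 <= t ->
  `|radial (t *: u) - t * G u| <= M + C + e * t.
Proof.
move=> u1 t0; have nt : `|t *: u| = t by rewrite normrZ u1 mulr1 ger0_norm.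
have t1 : 0 < 1 + t by rewrite ltr_pwDl.
rewrite /radial nt scalerA; set a := (_ * t) *: u.
have na : `|a| <= 1.
  by rewrite /a -scalerA -{1}nt norm_chart.
have au : t * `|a - u| <= 1.
  rewrite /a -[X in _ - X]scale1r -scalerBl normrZ u1 mulr1.
  have -> : (1 + t)^-1 * t - 1 = - (1 + t)^-1 by field; rewrite gt_eqF.
  by rewrite normrN ger0_norm ?invr_ge0 ?(ltW t1)// ler_pdivrMr// mul1r lerDr.
have -> : (1 + t) * G a - t * G u = G a + t * (G a - G u) by ring.
apply: le_trans (ler_normD _ _) _; rewrite normrM (ger0_norm t0).
have h1 : `|G a| <= M by exact: GM.
have h2 : t * `|G a - G u| <= t * (e + C * `|a - u|).
  by rewrite ler_wpM2l// GC// u1.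
have h3 : C * (t * `|a - u|) <= C * 1 by rewrite ler_wpM2l.
by move: h1 h2 h3; set v := `|a - u|; lra.
Qed.

(* For small q the increment is controlled by the modulus of continuity, for
   large q the function is compared with its recession function. *)
Lemma radial_concentration A q w : `|A| = 1 ->
  `|radial (A + q *: A + w) - radial A -
    (`|q| * ((G A + G (- A)) / 2) + q * ((G A - G (- A)) / 2))|
  <= 2 * e * (1 + `|q|) + (4 * M + 3 * C) * (`|w| + Num.min `|q| 1).
Proof.
move=> A1; have NA1 : `|- A| = 1 by rewrite normrN.
have GA : `|G A| <= M by rewrite GM ?A1.
have GNA : `|G (- A)| <= M by rewrite GM ?NA1.
have nqA : `|q *: A| = `|q| by rewrite normrZ A1 mulr1.
have w0 := normr_ge0 w; have q0 := normr_ge0 q.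
have Mw : 0 <= M * `|w| by rewrite mulr_ge0.
have Cw : 0 <= C * `|w| by rewrite mulr_ge0.
have Mq : 0 <= M * `|q| by rewrite mulr_ge0.
have Cq : 0 <= C * `|q| by rewrite mulr_ge0.
have eq0 : 0 <= e * `|q| by rewrite mulr_ge0.
have MC : 0 <= M + 2 * C by rewrite addr_ge0// mulr_ge0.
set T := _ + q * _.
(* [T] is [|q| G u] split into even and odd parts, hence linear in [|q|] and [q], the two quantities
   whose weak limits are known. *)
pose u : W := if 0 <= q then A else - A.
have u1 : `|u| = 1 by rewrite /u; case: ifP.
have TE : T = `|q| * G u.
  rewrite /T /u; have [h|h] := leP 0 q; first by rewrite ger0_norm//; field.
  by rewrite ltr0_norm//; field.
have qu : q *: A = `|q| *: u.
  rewrite /u; have [h|h] := leP 0 q; first by rewrite ger0_norm.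
  by rewrite ltr0_norm// scaleNr scalerN opprK.
have [q1|q1] := leP `|q| 1.
- have := radial_dist (A + q *: A + w) A.
  have -> : A + q *: A + w - A = q *: A + w by rewrite addrC !addrA addNr add0r.
  have : (M + 2 * C) * `|q *: A + w| <= (M + 2 * C) * (`|q| + `|w|).
    by rewrite ler_wpM2l// (le_trans (ler_normD _ _))// normrZ A1 mulr1.
  have : `|T| <= M * `|q|.
    by rewrite TE normrM normr_id mulrC ler_wpM2r// GM ?u1.
  have := ler_normB (radial (A + q *: A + w) - radial A) T.
  rewrite A1; lra.
- have := radial_dist (A + q *: A + w) (q *: A).
  have -> : A + q *: A + w - q *: A = A + w by rewrite addrAC addrK.
  have : (M + 2 * C) * `|A + w| <= (M + 2 * C) * (1 + `|w|).
    by rewrite ler_wpM2l// (le_trans (ler_normD _ _))// A1.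
  have := radial_recession u1 q0; rewrite -TE -qu.
  have := norm_radial A; rewrite A1.
  have -> : radial (A + q *: A + w) - radial A - T =
    (radial (A + q *: A + w) - radial (q *: A)) + (radial (q *: A) - T) - radial A.
    by ring.
  have := ler_normB (radial (A + q *: A + w) - radial (q *: A) + (radial (q *: A) - T)) (radial A).
  have := ler_normD (radial (A + q *: A + w) - radial (q *: A)) (radial (q *: A) - T).
  rewrite nqA; move: M0 e0 C0 Mw Cw eq0.
  set a1 := `|_ + _ - radial _|; set a2 := `|radial _ - radial _ + _|.
  set a3 := `|radial _ - radial _|; set a4 := `|radial A|.
  set a5 := `|radial _ - T|; set a6 := `|A + w|; set a7 := `|w|; set a8 := `|q|.
  lra.
Qed.

End radial_extension.

Section integrand.
Variables (R : realType) (d : nat) (W : finInnerType R).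
Local Notation rV := 'rV[R]_d.
Variables (Omega : set rV) (f g : rV * W -> R).
Hypotheses (oOmega : open Omega) (bOmega : bounded_set Omega).
Let K := closure (Omega `*` @unit_ball R W).
Hypotheses (cg : {within K, continuous g}).
Hypothesis gf : {in Omega `*` @unit_ball R W, g =1 sphere_transform f}.

Lemma integrand_domain_compact : compact K.
Proof.
have cO : compact (closure Omega).
  apply: bounded_closed_compact; last exact: closed_closure.
  have [M [_ MP]] := bOmega; exists (1 + `|M|); split; first exact: num_real.
  move=> y My x cx; apply: (@le_trans _ _ (1 + `|M|)); last exact: ltW.
  have cl : closed [set x : rV | `|x| <= 1 + `|M|].
    apply: (@closed_comp _ _ (fun r : rV => `|r|) [set x | x <= 1 + `|M|]) => //.
    by move=> r _; exact: norm_continuous.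
  apply: cl; apply: closureS cx => z Oz /=; apply: MP => //.
  by rewrite ltr_pwDl// ler_norm.
have cKB := compact_setX cO (@closed_unit_ball_compact R W).
apply: (subclosed_compact _ cKB); first exact: closed_closure.
have /compact_closed := cKB; move=> /(_ (@norm_hausdorff _ _)) cl.
move=> p Kp; apply: cl; apply: closureS Kp => -[x w] [/= Ox Bw].
by split => /=; [exact: subset_closure|exact: ltW].
Qed.

(** Points of the sphere are limits [t w] with [t < 1]; the values of [g] there represent the
    recession function. *)
Lemma integrand_domain x (w : W) : Omega x -> `|w| <= 1 -> K (x, w).
Proof.
move=> Ox w1 U [[P Q] /= [nP nQ] PQ].
have cw : t *: w @[t --> (1 : R)^'-] --> w.
  apply: cvg_at_left_filter; rewrite -[X in _ --> X]scale1r.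
  by apply: cvgZr_tmp; exact: cvg_id.
near (1 : R)^'- => t.
exists (x, t *: w); split; last first.
  apply: PQ; split=> /=; first exact: nbhs_singleton.
  by near: t; exact: (cw _ nQ).
have t0 : 0 < t by near: t; apply: nbhs_left_gt.
have t1 : t < 1 by near: t; exact: nbhs_left_lt.
split=> //=; rewrite /unit_ball /= normrZ gtr0_norm//.
by rewrite (le_lt_trans _ t1)// ler_piMr// ltW.
Unshelve. all: by end_near. Qed.

Lemma integrandE x z : Omega x -> f (x, z) = radial (fun w => g (x, w)) z.
Proof.
move=> Ox; have n1 : 0 < 1 + `|z| by rewrite ltr_pwDl.
have nz : `|(1 + `|z|)^-1 *: z| = `|z| / (1 + `|z|).
  by rewrite normrZ normfV ger0_norm ?(ltW n1)// mulrC.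
rewrite /radial gf; last first.
  rewrite inE; split => //=; rewrite /unit_ball /= nz ltr_pdivrMr// mul1r.
  by rewrite ltrDr.
rewrite /sphere_transform /= nz.
have -> : 1 - `|z| / (1 + `|z|) = (1 + `|z|)^-1 by field; rewrite gt_eqF.
by rewrite invrK scalerA mulfV ?gt_eqF// scale1r mulrA mulfV ?gt_eqF// mul1r.
Qed.

Lemma integrand_modulus (e : R) : 0 < e -> exists M C : R, [/\ 0 < M, 0 < C,
    forall x w, Omega x -> `|w| <= 1 -> `|g (x, w)| <= M &
    forall x y a b, Omega x -> Omega y -> `|a| <= 1 -> `|b| <= 1 ->
      `|g (x, a) - g (y, b)| <= e + C * Num.max `|x - y| `|a - b|].
Proof.
move=> e0.
have [M M0 gM] := within_continuous_compact_bounded integrand_domain_compact cg.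
have [C C0 gC] := within_continuous_compact_modulus integrand_domain_compact cg e0.
exists M, C; split=> //.
- by move=> x w Ox w1; apply: gM; exact: integrand_domain.
- move=> x y a b Ox Oy a1 b1.
  by apply: le_trans (gC (x, a) (y, b) (integrand_domain Ox a1) (integrand_domain Oy b1)) _.
Qed.

Lemma recessionE x z : Omega x -> `|z| = 1 -> recession Omega f x z = g (x, z).
Proof.
move=> Ox z1; rewrite /recession.
have nO : nbhs x Omega by exact: open_nbhs_nbhs.
have PF : ProperFilter (within Omega (nbhs x)).
  by apply: within_nbhs_proper; exact: subset_closure.
apply: cvg_lim => //; apply/cvgrPdist_le => e e0.
have e8 : 0 < e / 8 by rewrite divr_gt0.
have [M [C [M0 C0 gM gC]]] := integrand_modulus e8.
have MC : 0 < M + 2 * C by rewrite addr_gt0// mulr_gt0.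
have de : 0 < e / 8 / (M + 2 * C) by rewrite divr_gt0.
have dC : 0 < e / 8 / C by rewrite divr_gt0.
(* Beyond [T0] the constants [e / 8] and [M + C] are at most [e / 8] times [t]. Passing through [F2]
   and [t G1], the total error is then at most [7 e / 8] times [t]. *)
pose T0 := Num.max 1 ((M + C) / (e / 8)).
exists ([set p : rV * W | [/\ Omega p.1, `|x - p.1| < e / 8 / C &
    `|z - p.2| < e / 8 / (M + 2 * C)]], [set t : R | T0 < t]).
  split; last by exists T0; split; [exact: num_real|].
  exists ([set x' | Omega x' /\ `|x - x'| < e / 8 / C],
          [set z' | `|z - z'| < e / 8 / (M + 2 * C)]).
    split => /=; last by have := nbhsx_ballx z _ de; rewrite -ball_normE.
    have := nbhsx_ballx x _ dC; rewrite -ball_normE.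
    by apply: filterS => x' xx' Ox'.
  by move=> [x' z'] [/= [Ox' xx'] zz'].
move=> [[x' z'] t] /= [[Ox' xx' zz']]; rewrite /T0 gt_max => /andP[t1 tMC].
have t0 : 0 < t by lra.
have GM w : `|w| <= 1 -> `|g (x', w)| <= M by exact: gM.
have GC a b : `|a| <= 1 -> `|b| <= 1 ->
    `|g (x', a) - g (x', b)| <= e / 8 + C * `|a - b|.
  move=> a1 b1; have := gC _ _ _ _ Ox' Ox' a1 b1.
  by rewrite subrr normr0 max_r.
have h1 := radial_dist (ltW C0) GM GC (t *: z') (t *: z).
have h2 := radial_recession (ltW C0) GM GC z1 (ltW t0).
have z1' : `|z| <= 1 by rewrite z1.
have := gC x' x z z Ox' Ox z1' z1'.
rewrite subrr normr0 max_l// (distrC x') => h3.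
have h4 : (M + 2 * C) * `|t *: z' - t *: z| <= e / 8 * t.
  rewrite -scalerBr normrZ (gtr0_norm t0) mulrCA mulrC ler_wpM2r ?(ltW t0)//.
  by rewrite mulrC -ler_pdivlMr// distrC ltW.
have h5 : C * `|x - x'| <= e / 8 by rewrite mulrC -ler_pdivlMr// ltW.
have h6 : M + C <= e / 8 * t by rewrite mulrC -ler_pdivrMr// ltW.
have h7 : e / 8 * 1 <= e / 8 * t by rewrite ler_wpM2l// ltW.
rewrite integrandE//.
have -> : g (x, z) - radial (fun w => g (x', w)) (t *: z') / t =
    (g (x, z) * t - radial (fun w => g (x', w)) (t *: z')) / t.
  by field; rewrite gt_eqF.
rewrite normrM normfV (gtr0_norm t0) ler_pdivrMr//.
have h8 : `|t * g (x', z) - g (x, z) * t| <= t * (e / 8 + C * `|x - x'|).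
  by rewrite (mulrC _ t) -mulrBr normrM gtr0_norm// ler_wpM2l ?(ltW t0).
have h9 : t * (C * `|x - x'|) <= t * (e / 8) by rewrite ler_wpM2l// ltW.
move: h1 h2 h8; rewrite normrZ z1 mulr1 (gtr0_norm t0).
set F1 := radial _ (t *: z'); set F2 := radial _ (t *: z).
set G1 := g (x', z); set G2 := g (x, z) * t.
rewrite !ler_norml => /andP[? ?] /andP[? ?] /andP[? ?]; apply/andP; split; lra.
Unshelve. all: by end_near. Qed.

Lemma integrand_concentration (A : W) (e : R) : `|A| = 1 -> 0 < e ->
  exists2 C : R, 0 < C & forall x q (w : W), Omega x ->
  `|f (x, A + q *: A + w) - f (x, A) -
    (`|q| * ((g (x, A) + g (x, - A)) / 2) + q * ((g (x, A) - g (x, - A)) / 2))|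
  <= e * (1 + `|q|) + C * (`|w| + Num.min `|q| 1).
Proof.
move=> A1 e0; have e2 : 0 < e / 2 by rewrite divr_gt0.
have [M [C [M0 C0 gM gC]]] := integrand_modulus e2.
exists (4 * M + 3 * C); first by rewrite addr_gt0// mulr_gt0.
move=> x q w Ox; rewrite !integrandE//.
have := @radial_concentration _ _ (fun w => g (x, w)) M (e / 2) C (ltW M0) (ltW e2) (ltW C0) _ _ A q w A1.
rewrite (_ : 2 * (e / 2) = e); last by field.
apply; first by move=> a; exact: gM.
move=> a b a1 b1; have := gC _ _ _ _ Ox Ox a1 b1.
by rewrite subrr normr0 max_r.
Qed.

Lemma integrand_slice_modulus (A : W) (e : R) : `|A| <= 1 -> 0 < e ->
  exists M C : R, [/\ 0 < M, 0 < C, forall x, Omega x -> `|g (x, A)| <= M &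
    forall x y, Omega x -> Omega y -> `|g (x, A) - g (y, A)| <= e + C * `|x - y|].
Proof.
move=> A1 e0; have [M [C [M0 C0 gM gC]]] := integrand_modulus e0.
exists M, C; split => // [x Ox|x y Ox Oy]; first exact: gM.
by have := gC _ _ _ _ Ox Oy A1 A1; rewrite subrr normr0 max_l.
Qed.

End integrand.

(** * The generating sequence *)

Lemma within_continuous_comp (T U V : topologicalType) (D : set T) (E : set U)
    (gam : T -> U) (h : U -> V) :
  continuous gam -> (forall x, D x -> E (gam x)) -> {within E, continuous h} ->
  {within D, continuous (h \o gam)}.
Proof.
move=> cgam DE /subspace_continuousP ch; apply/subspace_continuousP => x Dx.
apply: cvg_comp (ch _ (DE _ Dx)).
move=> P; rewrite /within /= => nP.
suff : nbhs x (fun y => D y -> P (gam y)) by [].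
have nx : nbhs x (fun y => E (gam y) -> P (gam y)) := cgam x _ nP.
by apply: filterS nx => y yP Dy; apply: yP; exact: DE.
Qed.

Section two_point_integral.
Variables (R : realType) (W : finInnerType R) (A : W).

Lemma integral_two_point (D : set (borel W)) (h : borel W -> R) :
  measurable D -> D A -> D (- A) -> measurable_fun D h ->
  (\int[two_point A]_(z in D) (h z)%:E = ((h A + h (- A)) / 2)%:E)%E.
Proof.
move=> mD DA DNA mh.
have mh' : measurable_fun D (EFin \o h) by exact/measurable_EFinP.
have pos (f : borel W -> \bar R) : measurable_fun D f ->
    (forall z, D z -> 0 <= f z)%E ->
    (\int[two_point A]_(z in D) f z = (2^-1)%:E * (f A + f (- A)%R))%E.
  move=> mf f0; rewrite /two_point ge0_integral_mscale// ge0_integral_measure_add//.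
  by rewrite !integral_dirac// !diracE !mem_set// !mul1e.
rewrite integralE pos ?pos//; last 2 first.
- exact: measurable_funeneg.
- exact: measurable_funepos.
rewrite !funeposE !funenegE /= -!EFin_max /=.
apply: (congr1 EFin).
have maxE (t : R) : t = Num.max t 0 - Num.max (- t) 0.
  by case: (leP t 0) => ht; case: (leP (- t) 0) => ht'; lra.
by rewrite [X in (X + _) / 2]maxE [X in (_ + X) / 2](maxE (h (- A))); field.
Qed.

Lemma two_point_sphere : `|A| = 1 -> two_point A (@unit_sphere R W) = 1%E.
Proof.
move=> A1; rewrite /two_point /mscale /= /msum !big_ord_recl big_ord0 adde0 /=.
rewrite !diracE !mem_set//; last by rewrite /unit_sphere /= normrN.
by rewrite -EFinD -EFinM /= mulVf.
Qed.

Lemma closed_unit_sphere : closed (@unit_sphere R W).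
Proof.
apply: (@closed_comp _ _ (fun r : W => `|r|) [set 1]) => //.
by move=> r _; exact: norm_continuous.
Qed.

End two_point_integral.

Section bounded_measurable.
Variables (R : realType) (d : nat) (Omega : set 'rV[R]_d).
Local Notation mu := (@lebesgue_rV R d).
Local Notation T := (borel 'rV[R]_d).
Hypotheses (oOmega : open Omega) (Omegaoo : (mu Omega < +oo)%E).

Let mOmega : measurable (Omega : set T).
Proof. exact: open_borel_measurable. Qed.

(** Unlike the integrable functions, this class is stable under products; it consists of integrable
    functions because [Omega] has finite measure. *)
Definition bounded_meas (f : T -> R) :=
  measurable_fun (Omega : set T) f /\ exists C, forall x, Omega x -> `|f x| <= C.

Lemma bounded_meas_integrable f : bounded_meas f -> mu.-integrable Omega (EFin \o f).
Proof. by move=> [mf [C fC]]; exact: (bounded_integrable mOmega Omegaoo mf fC). Qed.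

Lemma bounded_meas_integralE f : bounded_meas f ->
  (\int[mu]_(x in Omega) (f x)%:E)%E = (\int[mu]_(x in Omega) f x)%:E.
Proof.
by move=> bf; rewrite /Rintegral fineK// integrable_fin_num//; exact: bounded_meas_integrable.
Qed.

Lemma bounded_meas_cst c : bounded_meas (fun=> c).
Proof. by split; [exact: measurable_cst|exists `|c|]. Qed.

Lemma bounded_measD f g : bounded_meas f -> bounded_meas g ->
  bounded_meas (fun x => f x + g x).
Proof.
move=> [mf [C fC]] [mg [C' gC']]; split; first exact: measurable_funD.
exists (C + C') => x Ox; apply: le_trans (ler_normD _ _) _.
by rewrite lerD ?fC ?gC'.
Qed.

Lemma bounded_measM f g : bounded_meas f -> bounded_meas g ->
  bounded_meas (fun x => f x * g x).
Proof.
move=> [mf [C fC]] [mg [C' gC']]; split; first exact: measurable_funM.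
by exists (C * C') => x Ox; rewrite normrM ler_pM ?fC ?gC'.
Qed.

Lemma bounded_measN f : bounded_meas f -> bounded_meas (fun x => - f x).
Proof.
move=> [mf [C fC]]; split; first exact: measurableT_comp.
by exists C => x Ox; rewrite normrN fC.
Qed.

Lemma bounded_measB f g : bounded_meas f -> bounded_meas g ->
  bounded_meas (fun x => f x - g x).
Proof. by move=> bf bg; apply: bounded_measD => //; exact: bounded_measN. Qed.

Lemma bounded_meas_norm f : bounded_meas f -> bounded_meas (fun x => `|f x|).
Proof.
move=> [mf [C fC]]; split; first exact: measurableT_comp.
by exists C => x Ox; rewrite normr_id fC.
Qed.

Lemma bounded_meas_continuous f (C : R) : {within Omega, continuous f} ->
  (forall x, Omega x -> `|f x| <= C) -> bounded_meas f.
Proof.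
move=> cf fC; split; last by exists C.
exact: within_continuous_measurable.
Qed.

End bounded_measurable.

(** * Concentrating pairs and their limit on integrands *)

Section concentration.
Variables (R : realType) (d k : nat) (W X : finInnerType R).
Variable Aop : multi_index d k -> 'Hom(W, X).
Variables (Omega : set 'rV[R]_d) (A : W).
Local Notation mu := (@lebesgue_rV R d).
Local Notation T := (borel 'rV[R]_d).
Hypotheses (oOmega : open Omega) (bOmega : bounded_set Omega).
Hypothesis Aop_rank : constant_rank Aop.
Hypotheses (A1 : `|A| = 1) (spA : linear_span (wave_cone Aop) A).

Let mOmega : measurable (Omega : set T).
Proof. exact: open_borel_measurable. Qed.

Let Omegaoo : (mu Omega < +oo)%E.
Proof. exact: bounded_lebesgue_rV_lty. Qed.

Let m := fine (mu Omega).

Let m0 : 0 <= m. Proof. exact: fine_ge0. Qed.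

(* The map w is (1 + q) A up to rho, and the trigonometric polynomial b replaces
   |q|. The last condition says that q is close to 0 and b to 1 weakly, uniformly
   over bounded Lipschitz test functions. *)
Definition concentrating_pair (e : R) (w : 'rV[R]_d -> W) (q b rho : 'rV[R]_d -> R) :=
  [/\ smooth_on setT w, forall x, diffop Aop w x = 0,
     [/\ continuous q, continuous b & continuous rho],
     exists C, forall x, [/\ `|q x| <= C, `|b x| <= C & `|rho x| <= C] &
     forall x, [/\ `|w x - A - q x *: A| <= rho x, `| `|q x| - b x| <= rho x &
       Num.min `|q x| 1 <= rho x]] /\
  [/\ \int[mu]_(x in Omega) rho x <= e,
      `|\int[mu]_(x in Omega) b x - m| <= e &
  forall phi : T -> R,
    measurable_fun (Omega : set T) phi -> (forall x, Omega x -> `|phi x| <= e^-1) ->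
    (forall x y, Omega x -> Omega y -> `|phi x - phi y| <= e^-1 * `|x - y|) ->
    `|\int[mu]_(x in Omega) (phi x * q x)| <= e /\
    `|\int[mu]_(x in Omega) (phi x * b x) - \int[mu]_(x in Omega) phi x| <= e].

Lemma concentrating_pair_exists (e : R) : 0 < e -> e <= 1 ->
  exists w q b rho, concentrating_pair e w q b rho.
Proof.
move=> e0 e1.
have A0 : A != 0 by rewrite -normr_eq0 A1 oner_eq0.
have [xi xi0] : exists xi : 'rV[R]_d, xi != 0.
  have [[|n] [c [v [vP AE]]]] := spA; first by rewrite AE big_ord0 eqxx in A0.
  by have [xi xi0 _] := vP ord0; exists xi.
have m1 : 0 < m + 1 by rewrite ltr_wpDl.
(* This gives [r m <= e / 2]; the weak limit of [rho] contributes the other [e / 2]. *)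
have e' : 0 < e / (2 * (m + 1)) by rewrite divr_gt0// mulr_gt0.
have [Z [q [b [rho [r [[aZ tq tb trho re] Zq]]]]]] :=
  concentrating_fields Aop_rank xi0 (two_sided_span Aop_rank A0 spA) e'.
have ie : 0 < e^-1 by rewrite invr_gt0.
have e2 : 0 < e / 2 by rewrite divr_gt0.
near \oo => n.
have Hq : forall phi : T -> R,
    measurable_fun (Omega : set T) phi -> (forall x, Omega x -> `|phi x| <= e^-1) ->
    (forall x y, Omega x -> Omega y -> `|phi x - phi y| <= e^-1 * `|x - y|) ->
    `|\int[mu]_(x in Omega) (phi x * q (n.+1%:R *: x)) -
      0 * \int[mu]_(x in Omega) phi x| <= e / 2.
  by near: n; exact: (trig_weak_limit oOmega Omegaoo tq ie e2).
have Hb : forall phi : T -> R,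
    measurable_fun (Omega : set T) phi -> (forall x, Omega x -> `|phi x| <= e^-1) ->
    (forall x y, Omega x -> Omega y -> `|phi x - phi y| <= e^-1 * `|x - y|) ->
    `|\int[mu]_(x in Omega) (phi x * b (n.+1%:R *: x)) -
      1 * \int[mu]_(x in Omega) phi x| <= e / 2.
  by near: n; exact: (trig_weak_limit oOmega Omegaoo tb ie e2).
have Hrho : forall phi : T -> R,
    measurable_fun (Omega : set T) phi -> (forall x, Omega x -> `|phi x| <= e^-1) ->
    (forall x y, Omega x -> Omega y -> `|phi x - phi y| <= e^-1 * `|x - y|) ->
    `|\int[mu]_(x in Omega) (phi x * rho (n.+1%:R *: x)) -
      r * \int[mu]_(x in Omega) phi x| <= e / 2.
  by near: n; exact: (trig_weak_limit oOmega Omegaoo trho ie e2).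
have e21 : e / 2 <= e by lra.
(* As [e <= 1], the constant 1 is an admissible test function; it yields the integrals of [rho] and
   [b]. *)
have phi1M x : Omega x -> `|(1 : R)| <= e^-1 by rewrite normr1 invf_ge1.
have phi1L (x y : 'rV[R]_d) : Omega x -> Omega y -> `|(1 : R) - 1| <= e^-1 * `|x - y|.
  by move=> _ _; rewrite subrr normr0 mulr_ge0// ltW.
have [smw dw] := afree_field_smooth n.+1%:R setT spA aZ.
have cdil (u : 'rV[R]_d -> R) l : is_trig u l -> continuous (fun x : 'rV[R]_d => u (n.+1%:R *: x)).
  move=> tu x; apply: continuous_comp; first exact: scaler_continuous.
  exact: (is_trig_continuous tu).
exists (fun x => A + Z (n.+1%:R *: x)), (fun x => q (n.+1%:R *: x)),
  (fun x => b (n.+1%:R *: x)), (fun x => rho (n.+1%:R *: x)).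
split; split=> //.
- by split; [exact: cdil tq|exact: cdil tb|exact: cdil trho].
- have [C1 _ qC] := is_trig_bounded tq; have [C2 _ bC] := is_trig_bounded tb.
  have [C3 _ rC] := is_trig_bounded trho; exists (Num.max C1 (Num.max C2 C3)) => x.
  by rewrite !le_max qC bC rC !orbT.
- by move=> x; have [h1 h2 h3] := Zq (n.+1%:R *: x); rewrite [A + _]addrC addrK.
- have := Hrho (fun=> 1) (measurable_cst _) phi1M phi1L.
  rewrite Rintegral_cst// mul1r -/m.
  under eq_Rintegral do rewrite mul1r.
  rewrite ler_norml => /andP[_].
  have : r * m <= e / 2.
    apply: (@le_trans _ _ (e / (2 * (m + 1)) * m)); first by rewrite ler_wpM2r.
    rewrite invfM !mulrA -mulrA ler_piMr ?(ltW e2)//.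
    by rewrite mulrC ler_pdivrMr// mul1r lerDl.
  lra.
- have := Hb (fun=> 1) (measurable_cst _) phi1M phi1L.
  rewrite Rintegral_cst// !mul1r -/m.
  under eq_Rintegral do rewrite mul1r.
  by move/le_trans; apply.
- move=> phi mphi phiM phiL; split.
    have := Hq phi mphi phiM phiL; rewrite mul0r subr0 => /le_trans; exact.
  by have := Hb phi mphi phiM phiL; rewrite mul1r => /le_trans; exact.
Unshelve. all: by end_near. Qed.

Section estimates.
Variables (e : R) (w : 'rV[R]_d -> W) (q b rho : 'rV[R]_d -> R).
Hypotheses (e0 : 0 < e) (pw : concentrating_pair e w q b rho).

Let cts (u : 'rV[R]_d -> R) : continuous u -> {within Omega, continuous u}.
Proof. exact: continuous_subspaceT. Qed.

Lemma concentrating_pair_bounded_meas :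
  [/\ bounded_meas Omega q, bounded_meas Omega b & bounded_meas Omega rho].
Proof.
have [[_ _ [cq cb crho] [C qC] _] _] := pw.
split; apply: (@bounded_meas_continuous _ _ _ oOmega _ C); try exact: cts.
- by move=> x _; have [] := qC x.
- by move=> x _; have [] := qC x.
- by move=> x _; have [] := qC x.
Qed.

Lemma concentrating_pair_continuous : continuous w.
Proof. by have [[sm _ _ _ _] _] := pw; move=> x; have [] := sm [::] x Logic.I. Qed.

Lemma concentrating_pair_norm x : `|w x| <= 1 + b x + 2 * rho x.
Proof.
have [[_ _ _ _ /(_ x)[h1 h2 _]] _] := pw.
have -> : w x = (w x - A - q x *: A) + (A + q x *: A).
  by rewrite -[w x - A - _]addrA -opprD subrK.
rewrite (le_trans (ler_normD _ _))//.
have : `|A + q x *: A| <= 1 + `|q x|.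
  by rewrite (le_trans (ler_normD _ _))// normrZ A1 mulr1.
by move: h1 h2; rewrite ler_norml => h1 /andP[_ h2]; lra.
Qed.

Lemma concentrating_pair_norm_meas : bounded_meas Omega (fun x => `|w x|).
Proof.
have [bq [mb [C bC]] [mr [C' rC]]] := concentrating_pair_bounded_meas.
apply: (@bounded_meas_continuous _ _ _ oOmega _ (1 + C + 2 * C')).
  apply: cts => x; apply: continuous_comp; first exact: concentrating_pair_continuous.
  exact: norm_continuous.
move=> x Ox; rewrite normr_id (le_trans (concentrating_pair_norm x))//.
have := bC x Ox; have := rC x Ox.
by rewrite !ler_norml => /andP[_ ?] /andP[_ ?]; lra.
Qed.

Let ibm := bounded_meas_integrable oOmega Omegaoo.

Lemma concentrating_pair_L1 :
  \int[mu]_(x in Omega) `|w x| <= 2 * m + 3 * e.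
Proof.
have [bq bb br] := concentrating_pair_bounded_meas.
have [_ [hr hb _]] := pw.
have b1 := bounded_meas_cst Omega 1.
have b2r : bounded_meas Omega (fun x => 2 * rho x).
  by apply: bounded_measM => //; exact: bounded_meas_cst.
apply: (@le_trans _ _ (\int[mu]_(x in Omega) (1 + b x + 2 * rho x))).
  apply: le_Rintegral => //.
  - exact: ibm concentrating_pair_norm_meas.
  - by apply: ibm; do 2!apply: bounded_measD => //.
  - by move=> x _; exact: concentrating_pair_norm.
rewrite RintegralD//; last 2 first.
- by apply: ibm; apply: bounded_measD.
- exact: ibm.
rewrite RintegralD//; [|exact: ibm..].
rewrite RintegralZl//; last exact: ibm.
rewrite Rintegral_cst// mul1r -/m.
by move: hb; rewrite ler_norml => /andP[_ hb]; lra.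
Qed.

(** On [E] the truncation equals 1, so [rho >= 1] and the integral of [rho] bounds the measure of
    [E]; moreover [|w| >= |q| - 1 - rho >= b - 3 rho] there. Off [E], [|q| <= rho] gives
    [b - 3 rho <= 0]. The integral of [b - 3 rho] over [Omega] is at least [m - 4 e]. *)
Lemma concentrating_pair_concentrates (E := Omega `&` [set x | 1 <= `|q x|]) :
  [/\ measurable (E : set T), fine (mu E) <= e &
    m - 4 * e <= \int[mu]_(x in E) `|w x|].
Proof.
have [bq bb br] := concentrating_pair_bounded_meas.
have [[_ _ [cq _ _] _ wq] [hr hb _]] := pw.
pose P : set T := [set x | 1 <= `|q x|].
have mP : measurable P.
  apply: closed_borel_measurable.
  apply: (@closed_comp _ _ (fun x => `|q x|) [set t | 1 <= t]) => //.
  move=> x _; apply: continuous_comp; first exact: cq.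
  exact: norm_continuous.
have mE : measurable (E : set T) by exact: measurableI.
have b1P : bounded_meas Omega (\1_P).
  split; first exact: measurable_indic.
  by exists 1 => x _; rewrite ger0_norm// indicE; case: (_ \in _).
have rho0 x : 0 <= rho x by have [h _ _] := wq x; exact: le_trans h.
split=> //.
  have -> : fine (mu E) = \int[mu]_(x in Omega) \1_P x.
    by rewrite /Rintegral integral_indic// setIC.
  apply: le_trans hr; apply: le_Rintegral => //; [exact: ibm..|].
  move=> x Ox; rewrite indicE; have [|_ //] := boolP (x \in P).
  by rewrite inE /P /= => q1; have [_ _] := wq x; rewrite min_r.
rewrite Rintegral_mkcondr.
have bwP : bounded_meas Omega ((fun x => `|w x|) \_ P).
  have -> : (fun x => `|w x|) \_ P = fun x => `|w x| * \1_P x.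
    by apply/funext => x; rewrite patchE indicE; case: ifP => _; rewrite ?mulr1 ?mulr0.
  exact: bounded_measM concentrating_pair_norm_meas b1P.
have b3r : bounded_meas Omega (fun x => 3 * rho x).
  by apply: bounded_measM => //; exact: bounded_meas_cst.
apply: (@le_trans _ _ (\int[mu]_(x in Omega) (b x - 3 * rho x))).
  rewrite RintegralB//; [|exact: ibm..].
  rewrite RintegralZl//; last exact: ibm.
  by move: hb; rewrite ler_norml => /andP[hb _]; lra.
apply: le_Rintegral => //; [apply: ibm; exact: bounded_measB|exact: ibm|].
move=> x _; have [h1 h2 h3] := wq x; rewrite patchE.
move: h2; rewrite ler_norml => /andP[h2 _].
case: ifPn => xP.
  move: xP; rewrite inE /P /= => q1; rewrite min_r// in h3.
  have : `|A + q x *: A| <= `|w x| + rho x.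
    have -> : A + q x *: A = w x - (w x - A - q x *: A).
      by rewrite -[w x - A - _]addrA -opprD subKr.
    by rewrite (le_trans (ler_normB _ _))// lerD2l.
  have : `|q x| - 1 <= `|A + q x *: A|.
    by rewrite [A + _]addrC; have := lerB_normD (q x *: A) A; rewrite normrZ A1 mulr1.
  lra.
move: xP; rewrite notin_setE /P /= => /negP; rewrite -ltNge => q1.
rewrite -[X in _ <= X]/(0 : R).
by move: h3; rewrite min_l ?(ltW q1)// => h3; have := rho0 x; lra.
Qed.

End estimates.

(** Trades [|q|] for [b] and the merely continuous [phi] for the Lipschitz [psi]. The terms
    [psi1 b - psi1] and [psi2 q] integrate to almost 0, and the bound is linear in [b] and [rho],
    whose integrals are controlled. *)
Lemma concentration_error (F q b rho phi1 phi2 psi1 psi2 eta C M : R) :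
  0 <= eta -> 0 <= C -> `|phi1| <= M -> `|phi1 - psi1| <= eta ->
  `|phi2 - psi2| <= eta -> `| `|q| - b| <= rho ->
  `|F - (`|q| * phi1 + q * phi2)| <= eta * (1 + `|q|) + C * (rho + rho) ->
  `|F - phi1 - (psi1 * b - psi1 + psi2 * q)| <=
    eta * 2 + eta * 3 * b + (2 * C + M + 4 * eta) * rho.
Proof.
move=> eta0 C0 phiM p1 p2 qb hF.
have q0 := normr_ge0 q; have rho0 : 0 <= rho := le_trans (normr_ge0 _) qb.
have M0 : 0 <= M := le_trans (normr_ge0 _) phiM.
have /andP[qb1 qb2] : (- rho <= `|q| - b) && (`|q| - b <= rho) by rewrite -ler_norml.
have e1 : `|(`|q| - b) * phi1| <= rho * M by rewrite normrM ler_pM.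
have e2 : `|(b - 1) * (phi1 - psi1)| <= (b + 2 * rho + 1) * eta.
  rewrite normrM ler_pM// (le_trans (ler_normB _ _))// normr1 lerD2r.
  by rewrite ler_norml; apply/andP; split; lra.
have e3 : `|q * (phi2 - psi2)| <= `|q| * eta by rewrite normrM ler_wpM2l.
have e4 : eta * `|q| <= eta * (b + rho) by rewrite ler_wpM2l//; lra.
have -> : F - phi1 - (psi1 * b - psi1 + psi2 * q) =
    (F - (`|q| * phi1 + q * phi2)) + (`|q| - b) * phi1 +
    (b - 1) * (phi1 - psi1) + q * (phi2 - psi2) by ring.
move: hF e1 e2 e3; set a1 := F - _; set a2 := _ * phi1; set a3 := _ * (phi1 - _).
set a4 := q * _.
have := ler_normD (a1 + a2 + a3) a4; have := ler_normD (a1 + a2) a3.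
have := ler_normD a1 a2; lra.
Qed.

Lemma pair_continuous (v : 'rV[R]_d -> W) :
  continuous v -> continuous (fun x : 'rV[R]_d => (x, v x)).
Proof.
move=> cv x; apply: (@cvg_pair _ _ _ (nbhs x) (nbhs x) (nbhs (v x)) _ _ _ id v).
  exact: cvg_id.
exact: cv.
Qed.

Lemma slice_bounded_meas (g : 'rV[R]_d * W -> R) (z : W) :
  {within closure (Omega `*` @unit_ball R W), continuous g} -> `|z| <= 1 ->
  bounded_meas Omega (fun x => g (x, z)).
Proof.
move=> cg z1.
have [M [_ [_ _ gM _]]] := integrand_slice_modulus bOmega cg z1 ltr01.
apply: (bounded_meas_continuous oOmega _ gM).
apply: (within_continuous_comp (pair_continuous (v := fun=> z) _) _ cg) => x.
  exact: cst_continuous.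
by move=> Ox; exact: integrand_domain.
Qed.

Lemma integrand_bounded_meas (f g : 'rV[R]_d * W -> R) (v : 'rV[R]_d -> W) (C : R) :
  {within Omega `*` setT, continuous f} ->
  {within closure (Omega `*` @unit_ball R W), continuous g} ->
  {in Omega `*` @unit_ball R W, g =1 sphere_transform f} ->
  continuous v -> (forall x, Omega x -> `|v x| <= C) ->
  bounded_meas Omega (fun x => f (x, v x)).
Proof.
move=> cf cg gf cv vC.
have [M [_ [M0 _ gM _]]] := integrand_modulus bOmega cg ltr01.
apply: (@bounded_meas_continuous _ _ _ oOmega _ ((1 + C) * M)).
  exact: (within_continuous_comp (pair_continuous cv) _ cf).
move=> x Ox; rewrite (integrandE gf)//.
have h : `|radial (fun w => g (x, w)) (v x)| <= (1 + `|v x|) * M.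
  by apply: norm_radial => // a; exact: gM.
by apply: (le_trans h); rewrite ler_wpM2r ?(ltW M0)// lerD2l vC.
Qed.

(** The even and odd parts [phi1], [phi2] of the recession function are only uniformly continuous,
    while a pair is tested against Lipschitz functions; hence the detour through [psi1] and
    [psi2]. *)
Lemma concentrating_pair_limit (f g : 'rV[R]_d * W -> R) (e : R) :
  {within Omega `*` setT, continuous f} ->
  {within closure (Omega `*` @unit_ball R W), continuous g} ->
  {in Omega `*` @unit_ball R W, g =1 sphere_transform f} -> 0 < e ->
  exists2 dl : R, 0 < dl & forall e' w q b rho, 0 < e' -> e' <= dl ->
    concentrating_pair e' w q b rho ->
    `|\int[mu]_(x in Omega) f (x, w x) - \int[mu]_(x in Omega) f (x, A) -
      \int[mu]_(x in Omega) ((g (x, A) + g (x, - A)) / 2)| <= e.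
Proof.
move=> cf cg gf e0.
have ibm := bounded_meas_integrable oOmega Omegaoo.
have NA1 : `|- A| = 1 by rewrite normrN.
have [A1' NA1'] : `|A| <= 1 /\ `|- A| <= 1 by rewrite A1 NA1.
have m7 : 0 < 5 * m + 7 by rewrite ltr_wpDl// mulr_ge0.
(* The terms in [eta] add up to at most [2 m + 3 (m + 1) + 4 = 5 m + 7] times [eta], that is
   [e / 2]. *)
pose eta := e / (2 * (5 * m + 7)).
have eta0 : 0 < eta by rewrite divr_gt0// mulr_gt0.
have [C C0 fC] := integrand_concentration bOmega cg gf A1 eta0.
have [M1 [C1 [M10 C10 gM1 gC1]]] := integrand_slice_modulus bOmega cg A1' eta0.
have [M2 [C2 [M20 C20 gM2 gC2]]] := integrand_slice_modulus bOmega cg NA1' eta0.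
pose phi1 (x : T) := (g (x, A) + g (x, - A)) / 2.
pose phi2 (x : T) := (g (x, A) - g (x, - A)) / 2.
have phi1M x : Omega x -> `|phi1 x| <= M1 + M2.
  move=> Ox; have := gM1 x Ox; have := gM2 x Ox.
  by rewrite /phi1 !ler_norml => /andP[? ?] /andP[? ?]; apply/andP; split; lra.
have phi2M x : Omega x -> `|phi2 x| <= M1 + M2.
  move=> Ox; have := gM1 x Ox; have := gM2 x Ox.
  by rewrite /phi2 !ler_norml => /andP[? ?] /andP[? ?]; apply/andP; split; lra.
have C12 : 0 <= C1 + C2 by rewrite addr_ge0 ?ltW.
have phi1C x y : Omega x -> Omega y ->
    `|phi1 x - phi1 y| <= eta + (C1 + C2) * `|x - y|.
  move=> Ox Oy; have := gC1 x y Ox Oy; have := gC2 x y Ox Oy.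
  have := mulr_ge0 (ltW C10) (normr_ge0 (x - y)).
  have := mulr_ge0 (ltW C20) (normr_ge0 (x - y)).
  rewrite /phi1 !ler_norml => ? ? /andP[? ?] /andP[? ?]; apply/andP; split; lra.
have phi2C x y : Omega x -> Omega y ->
    `|phi2 x - phi2 y| <= eta + (C1 + C2) * `|x - y|.
  move=> Ox Oy; have := gC1 x y Ox Oy; have := gC2 x y Ox Oy.
  have := mulr_ge0 (ltW C10) (normr_ge0 (x - y)).
  have := mulr_ge0 (ltW C20) (normr_ge0 (x - y)).
  rewrite /phi2 !ler_norml => ? ? /andP[? ?] /andP[? ?]; apply/andP; split; lra.
have [psi1 [psi1M psi1L psi1e]] := lipschitz_approximation C12 phi1M phi1C.
have [psi2 [psi2M psi2L psi2e]] := lipschitz_approximation C12 phi2M phi2C.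
(* [e' <= 1 / B] makes both [psi1] and [psi2] admissible test functions. *)
pose B := M1 + M2 + (C1 + C2) + 1.
have B0 : 0 < B by rewrite ltr_wpDl// !addr_ge0 ?ltW.
(* Collects the factors of [e']: those of the integral of [rho], and 2 for the two tests. *)
pose N := 2 * C + (M1 + M2) + 2.
have N0 : 0 < N by rewrite ltr_wpDl// !addr_ge0 ?mulr_ge0 ?ltW.
exists (Num.min 1 (Num.min B^-1 (e / (2 * N)))).
  by rewrite !lt_min ltr01 invr_gt0 B0 divr_gt0// mulr_gt0.
move=> e' w q b rho e'0; rewrite !le_min => /and3P[e'1 e'B e'N] pw.
have ie'B : B <= e'^-1 by rewrite -[B]invrK lef_pV2// posrE ?invr_gt0.
have [bq bb br] := concentrating_pair_bounded_meas pw.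
have [[_ _ _ _ wq] [hr hb hphi]] := pw.
have bL psi : (forall x, Omega x -> `|psi x| <= M1 + M2) ->
    (forall x y, Omega x -> Omega y -> `|psi x - psi y| <= (C1 + C2) * `|x - y|) ->
    bounded_meas Omega psi.
  move=> psiM psiL; apply: (bounded_meas_continuous oOmega _ psiM).
  exact: lipschitz_within_continuous psiL.
have test psi : (forall x, Omega x -> `|psi x| <= M1 + M2) ->
    (forall x y, Omega x -> Omega y -> `|psi x - psi y| <= (C1 + C2) * `|x - y|) ->
    `|\int[mu]_(x in Omega) (psi x * q x)| <= e' /\
    `|\int[mu]_(x in Omega) (psi x * b x) - \int[mu]_(x in Omega) psi x| <= e'.
  move=> psiM psiL; have [mpsi _] := bL psi psiM psiL.
  apply: hphi => // [x Ox|x y Ox Oy].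
    apply: le_trans (psiM x Ox) (le_trans _ ie'B); rewrite /B; lra.
  apply: le_trans (psiL x y Ox Oy) _; rewrite ler_wpM2r// (le_trans _ ie'B)// /B; lra.
have bphi1 : bounded_meas Omega phi1.
  apply: bounded_measM; last exact: bounded_meas_cst.
  by apply: bounded_measD; exact: slice_bounded_meas.
have bfA : bounded_meas Omega (fun x => f (x, A)).
  apply: (integrand_bounded_meas cf cg gf _ (v := fun=> A) (C := 1)) => // x.
  exact: cst_continuous.
have bfw : bounded_meas Omega (fun x => f (x, w x)).
  have [_ [Cw wC]] := concentrating_pair_norm_meas pw.
  apply: (integrand_bounded_meas cf cg gf (concentrating_pair_continuous pw) (C := Cw)).
  by move=> x Ox; have := wC x Ox; rewrite normr_id.
have [b1 b2] := (bL _ psi1M psi1L, bL _ psi2M psi2L).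
have [[_ t1] [t2 _]] := (test _ psi1M psi1L, test _ psi2M psi2L).
have bp1 := bounded_measM b1 bb; have bp2 := bounded_measM b2 bq.
pose D x := f (x, w x) - f (x, A) - phi1 x - (psi1 x * b x - psi1 x + psi2 x * q x).
have bD0 := bounded_measB (bounded_measB bfw bfA) bphi1.
have bD1 := bounded_measD (bounded_measB bp1 b1) bp2.
have bD : bounded_meas Omega D by exact: bounded_measB.
have DE : \int[mu]_(x in Omega) D x =
    (\int[mu]_(x in Omega) f (x, w x) - \int[mu]_(x in Omega) f (x, A) -
      \int[mu]_(x in Omega) phi1 x) -
    (\int[mu]_(x in Omega) (psi1 x * b x) - \int[mu]_(x in Omega) psi1 x +
     \int[mu]_(x in Omega) (psi2 x * q x)).
  rewrite /D RintegralB//; [|exact: ibm..].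
  rewrite RintegralB//; [|apply: ibm; exact: bounded_measB|exact: ibm].
  rewrite RintegralB//; [|exact: ibm..].
  rewrite RintegralD//; [|apply: ibm; exact: bounded_measB|exact: ibm].
  by rewrite RintegralB//; exact: ibm.
have bcst c : bounded_meas Omega (fun=> c) by exact: bounded_meas_cst.
pose E x := eta * 2 + eta * 3 * b x + (2 * C + (M1 + M2) + 4 * eta) * rho x.
have bE1 := bounded_measM (bcst (eta * 3)) bb.
have bE2 := bounded_measM (bcst (2 * C + (M1 + M2) + 4 * eta)) br.
have bE : bounded_meas Omega E by do 2!apply: bounded_measD => //.
have hD : `|\int[mu]_(x in Omega) D x| <= \int[mu]_(x in Omega) E x.
  apply: le_trans (le_normr_Rintegral mOmega (ibm _ bD)) _.
  apply: le_Rintegral => //.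
  - by apply: ibm; exact: bounded_meas_norm.
  - exact: ibm.
  - move=> x Ox; have [h1 h2 h3] := wq x.
    apply: (concentration_error (ltW eta0) (ltW C0) (phi1M x Ox) (psi1e x Ox) (psi2e x Ox) h2).
    have := fC x (q x) (w x - A - q x *: A) Ox.
    have -> : A + q x *: A + (w x - A - q x *: A) = w x.
      by rewrite [LHS]addrC -[w x - A - _]addrA -opprD subrK.
    move/le_trans; apply; rewrite lerD2l ler_wpM2l ?(ltW C0)// lerD//.
have EE : \int[mu]_(x in Omega) E x = eta * 2 * m + eta * 3 * \int[mu]_(x in Omega) b x +
    (2 * C + (M1 + M2) + 4 * eta) * \int[mu]_(x in Omega) rho x.
  rewrite /E RintegralD//; last 2 first.
  - by apply: ibm; exact: (bounded_measD (bcst _)).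
  - exact: ibm.
  rewrite RintegralD//; [|exact: ibm (bcst _)|exact: ibm].
  by rewrite Rintegral_cst// !RintegralZl//; exact: ibm.
move: hb hr t1 t2 hD; rewrite DE EE.
set I1 := _ - \int[mu]_(x in Omega) phi1 x.
set I2 := \int[mu]_(x in Omega) b x; set I3 := \int[mu]_(x in Omega) rho x.
set I4 := _ - \int[mu]_(x in Omega) psi1 x; set I5 := \int[mu]_(x in Omega) (psi2 x * q x).
move=> hb hr t1 t2 hD.
have k1 : eta * 3 * I2 <= eta * 3 * (m + 1).
  apply: ler_wpM2l; first by rewrite mulr_ge0 ?(ltW eta0).
  by move: hb; rewrite ler_norml => /andP[_ ?]; lra.
have k2 : (2 * C + (M1 + M2) + 4 * eta) * I3 <= (2 * C + (M1 + M2) + 4 * eta) * e'.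
  by apply: ler_wpM2l => //; lra.
have k3 : eta * e' <= eta * 1 by rewrite ler_wpM2l ?(ltW eta0).
have k4 : eta * (5 * m + 7) = e / 2 by rewrite /eta; field; rewrite gt_eqF.
have k5 : N * e' <= e / 2.
  rewrite mulrC -ler_pdivlMr// (le_trans e'N)//.
  by rewrite invfM mulrA.
have k6 : `|I1| <= `|I1 - (I4 + I5)| + `|I4| + `|I5|.
  rewrite -addrA (le_trans _ (lerD (lexx _) (ler_normD I4 I5)))//.
  by rewrite -{1}[I1](subrK (I4 + I5)) ler_normD.
move: k5; rewrite /N; lra.
Qed.

End concentration.

Theorem corollary3p3 (R : realType) (d k : nat) (W X : finInnerType R)
    (Aop : multi_index d k -> 'Hom(W, X)) (Omega : set 'rV[R]_d) (A : W) :
  open Omega -> bounded_set Omega ->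
  @lebesgue_rV R d (closure Omega `\` interior Omega) = 0%E ->
  constant_rank Aop ->
  (@unit_sphere R W `&` linear_span (wave_cone Aop)) A ->
  (exists w : nat -> 'rV[R]_d -> W,
    [/\ forall j, smooth_on Omega (w j),
        forall j x, Omega x -> diffop Aop (w j) x = 0,
        L1_bounded Omega w,
        generates Omega w A (two_point A) &
        Omega !=set0 -> ~ equi_integrable Omega w]) /\
  (~ wave_cone Aop A ->
   forall A1 A2 : W, A1 = A -> A2 = - A -> ~ wave_cone Aop (A1 - A2)).
Proof.
move=> oO bO _ rA [A1 spA]; split; last first.
  (* [A - (- A) = 2 A], and each kernel is a linear subspace. *)
  move=> nA _ _ -> -> [xi xi0]; rewrite opprK -mulr2n -scaler_nat => kA; apply: nA.
  exists xi => //; rewrite -[A](@scalerK _ _ 2%:R) ?pnatr_eq0//.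
  exact: memvZ.
have mO : measurable (Omega : set (borel 'rV[R]_d)) by exact: open_borel_measurable.
have Ooo : (lebesgue_rV (Omega : set (borel 'rV[R]_d)) < +oo)%E by exact: bounded_lebesgue_rV_lty.
have s0 j : 0 < j.+1%:R^-1 :> R by rewrite invr_gt0 ltr0n.
have s1 j : j.+1%:R^-1 <= 1 :> R by rewrite invf_le1 ?ltr0n// ler1n.
have /choice[w wP] j : exists w, exists q b rho,
    concentrating_pair Aop Omega A j.+1%:R^-1 w q b rho.
  exact: concentrating_pair_exists.
have bw j : bounded_meas Omega (fun x => `|w j x|).
  have [q [b [rho pw]]] := wP j.
  exact: (concentrating_pair_norm_meas oO A1 pw).
pose m := fine (lebesgue_rV (Omega : set (borel 'rV[R]_d))).
have L1w j : \int[@lebesgue_rV R d]_(x in Omega) `|w j x| <= 2 * m + 3.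
  have [q [b [rho pw]]] := wP j.
  apply: le_trans (concentrating_pair_L1 oO bO A1 pw) _.
  by rewrite lerD2l ler_piMr.
exists w; split.
- move=> j s x _; have [q [b [rho [[sm _ _ _ _] _]]]] := wP j.
  exact: sm.
- by move=> j x _; have [q [b [rho [[_ dw _ _ _] _]]]] := wP j.
- exists (2 * m + 3) => j.
  by rewrite (bounded_meas_integralE oO Ooo (bw j)) lee_fin.
- split.
  + move=> j; have [q [b [rho pw]]] := wP j; split.
      apply: within_continuous_borel_measurable => //.
      exact/continuous_subspaceT/(concentrating_pair_continuous pw).
    by rewrite (bounded_meas_integralE oO Ooo (bw j)) ltry.
  + exact: two_point_sphere.
  + move=> f [cf [g cg gf]].
    have bfA : bounded_meas Omega (fun x => f (x, A)).
      apply: (integrand_bounded_meas oO bO cf cg gf (v := fun=> A) (C := 1)) => [x|x _].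
        exact: cst_continuous.
      by rewrite A1.
    have bfw j : bounded_meas Omega (fun x => f (x, w j x)).
      have [q [b [rho pw]]] := wP j; have [_ [C wC]] := bw j.
      apply: (integrand_bounded_meas oO bO cf cg gf (concentrating_pair_continuous pw) (C := C)).
      by move=> x Ox; have := wC x Ox; rewrite normr_id.
    have bav : bounded_meas Omega (fun x => (g (x, A) + g (x, - A)) / 2).
      apply: bounded_measM; last exact: bounded_meas_cst.
      by apply: bounded_measD; apply: slice_bounded_meas => //; rewrite ?normrN A1.
    have mS : measurable (@unit_sphere R W : set (borel W)).
      by apply: closed_borel_measurable; exact: closed_unit_sphere.
    (* On the sphere the recession function is the boundary value of [g], averaged by the two-point
       measure over [A] and [- A]. *)
    have -> : (\int[@lebesgue_rV R d]_(x in Omega)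
        \int[two_point A]_(z in @unit_sphere R W) (recession Omega f x z)%:E)%E =
        (\int[@lebesgue_rV R d]_(x in Omega) ((g (x, A) + g (x, - A)) / 2)%:E)%E.
      apply: eq_integral => x; rewrite inE => Ox.
      rewrite -(@integral_two_point _ _ _ (@unit_sphere R W) (fun z => g (x, z)))//.
      * apply: eq_integral => z; rewrite inE => z1.
        by rewrite (recessionE oO bO cg gf).
      * by rewrite /unit_sphere /= normrN.
      * apply: within_continuous_measurable => //.
        apply: (@within_continuous_comp _ _ _ (@unit_sphere R W) _ (pair x) g _ _ cg).
          move=> z; apply: (@cvg_pair _ _ _ (nbhs z) (nbhs x) (nbhs z) _ _ _ (fun=> x) id).
            exact: cvg_cst.
          exact: cvg_id.
        by move=> z z1; apply: integrand_domain => //; rewrite z1.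
    have -> : (fun j => \int[@lebesgue_rV R d]_(x in Omega) (f (x, w j x))%:E)%E =
        (fun j => (\int[@lebesgue_rV R d]_(x in Omega) f (x, w j x))%:E).
      by apply/funext => j; rewrite (bounded_meas_integralE oO Ooo (bfw j)).
    rewrite (bounded_meas_integralE oO Ooo bfA) (bounded_meas_integralE oO Ooo bav).
    rewrite -EFinD; apply: cvg_EFin; first by near=> j.
    apply/cvgrPdist_le => e e0.
    have [dl dl0 dlP] := concentrating_pair_limit Aop oO bO A1 cf cg gf e0.
    near=> j; have [q [b [rho pw]]] := wP j.
    have jdl : j.+1%:R^-1 <= dl.
      by apply: ltW; near: j; exact: (near_infty_natSinv_lt (PosNum dl0)).
    have := dlP _ _ _ _ _ (s0 j) jdl pw.
    by rewrite -addrA -opprD distrC.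
- move=> O0 ei.
  have m0 : 0 < m.
    by apply: fine_gt0; rewrite open_lebesgue_rV_gt0.
  (* Once [1 / (j + 1) < m / 8], the integral of [|w j|] over [E] exceeds [m - 4 (m / 8) = m / 2],
     above the tolerance [m / 4], although [E] has measure at most [1 / (j + 1)]. *)
  have m4 : 0 < m / 4 by rewrite divr_gt0.
  have m8 : 0 < m / 8 by rewrite divr_gt0.
  have [dl dl0 dlP] := ei _ m4.
  near \oo => j.
  have jdl : j.+1%:R^-1 <= dl.
    by apply: ltW; near: j; exact: (near_infty_natSinv_lt (PosNum dl0)).
  have jm : j.+1%:R^-1 < m / 8.
    by near: j; exact: (near_infty_natSinv_lt (PosNum m8)).
  have [q [b [rho pw]]] := wP j.
  have [mE muE wE] := concentrating_pair_concentrates oO bO A1 pw.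
  move: mE muE wE; set E := _ `&` _ => mE muE wE.
  have EO : E `<=` Omega by exact: subIsetl.
  have Eoo := measure_ltyS mE mO EO Ooo.
  have /(dlP E mE EO) : (lebesgue_rV (E : set (borel 'rV[R]_d)) <= dl%:E)%E.
    by rewrite -[leLHS]fineK ?ge0_fin_numE// lee_fin (le_trans muE).
  move=> /(le_trans (ereal_sup_ubound _)) h.
  have : (\int[@lebesgue_rV R d]_(x in E) `|w j x|%:E <= (m / 4)%:E)%E.
    by apply: h; exists j.
  have -> : (\int[@lebesgue_rV R d]_(x in E) `|w j x|%:E)%E =
      (\int[@lebesgue_rV R d]_(x in E) `|w j x|)%:E.
    rewrite /Rintegral fineK// integrable_fin_num//.
    by apply: (integrableS mO mE EO); exact: bounded_meas_integrable.
  rewrite lee_fin; move: wE jm; rewrite -/m.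
  set u := \int[_]_(x in _) _; set v := j.+1%:R^-1; lra.
Unshelve. all: by end_near. Qed.
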